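(* Let $c>0$ be an arbitrary controller gain. Suppose that the initial data $(T_{\rm l,0},T_{\rm s,0},s_0)$ satisfy Assumption (A1) and Assumption (A2), and that the setpoint $s_{\rm r}$ satisfies Assumption (A3), namely $s_\infty<s_{\rm r}<L$ (all stated in the context). Consider the closed-loop system consisting of the two-phase Stefan problem $$\partial_t T_{\rm l}(x,t)=\alpha_{\rm l}\,\partial_{xx}T_{\rm l}(x,t)\ \ (0<x<s(t)),\qquad \partial_t T_{\rm s}(x,t)=\alpha_{\rm s}\,\partial_{xx}T_{\rm s}(x,t)\ \ (s(t)<x<L),$$ $$\partial_x T_{\rm l}(0,t)=-\frac{q_{\rm c}(t)}{k_{\rm l}},\quad \partial_x T_{\rm s}(L,t)=0,\quad T_{\rm l}(s(t),t)=T_{\rm m},\quad T_{\rm s}(s(t),t)=T_{\rm m},$$ $$\gamma\,\dot s(t)=-k_{\rm l}\,\partial_xT_{\rm l}(s(t),t)+k_{\rm s}\,\partial_xT_{\rm s}(s(t),t),$$ with initial data $T_{\rm l}(\cdot,0)=T_{\rm l,0}$, $T_{\rm s}(\cdot,0)=T_{\rm s,0}$, $s(0)=s_0$, and the feedback control law $$q_{\rm c}(t)=-c\left(\frac{k_{\rm l}}{\alpha_{\rm l}}\int_0^{s(t)}(T_{\rm l}(x,t)-T_{\rm m})\,dx+\frac{k_{\rm s}}{\alpha_{\rm s}}\int_{s(t)}^{L}(T_{\rm s}(x,t)-T_{\rm m})\,dx+\gamma\,(s(t)-s_{\rm r})\right).$$ Then the closed-loop system maintains the model validity conditions $$T_{\rm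 l}(x,t)\ge T_{\rm m}\ \ \forall x\in(0,s(t)),\qquad T_{\rm s}(x,t)\le T_{\rm m}\ \ \forall x\in(s(t),L),\qquad 0<s(t)<L,\qquad \forall t>0,$$ and there exists a constant $M>0$ such that $$\Psi(t)\le M\,\Psi(0)\,e^{-dt}\qquad\text{for all } t\ge 0,\qquad d=\frac12\min\left\{\frac{\alpha_{\rm l}}{2L^2},\frac{\alpha_{\rm s}}{L^2},c\right\},$$ where $$\Psi(t)=\int_0^{s(t)}(T_{\rm l}(x,t)-T_{\rm m})^2\,dx+\int_{s(t)}^{L}(T_{\rm s}(x,t)-T_{\rm m})^2\,dx+(s(t)-s_{\rm r})^2 .$$
   Context: The constants $L$ (material length), $\alpha_{\rm l},\alpha_{\rm s}$ (diffusivities), $k_{\rm l},k_{\rm s}$ (thermal conductivities) and $\gamma$ (density times latent heat) are positive; $T_{\rm m}\in\mathbb R$ is the melting temperature. The unknowns are the liquid temperature $T_{\rm l}(x,t)$ on $0\le x\le s(t)$, the solid temperature $T_{\rm s}(x,t)$ on $s(t)\le x\le L$, and the interface position $s(t)$; $q_{\rm c}(t)$ is the boundary heat input. Solutions are understood in the classical sense. Assumption (A1): $0<s_0<L$; $T_{\rm l,0}$ on $[0,s_0]$ and $T_{\rm s,0}$ on $[s_0,L]$ are piecewise continuous, and there exist constants $H_{\rm l}>0$, $H_{\rm s}>0$ such that $T_{\rm m}\le T_{\rm l,0}(x)\le T_{\rm m}+H_{\rm l}(s_0-x)$ for all $x\in[0,s_0]$, and $T_{\rm m}\ge T_{\rm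 s,0}(x)\ge T_{\rm m}+H_{\rm s}(s_0-x)$ for all $x\in[s_0,L]$. Define $$s_\infty:=s_0+\frac{k_{\rm l}}{\alpha_{\rm l}\gamma}\int_0^{s_0}(T_{\rm l,0}(x)-T_{\rm m})\,dx+\frac{k_{\rm s}}{\alpha_{\rm s}\gamma}\int_{s_0}^{L}(T_{\rm s,0}(x)-T_{\rm m})\,dx .$$ Assumption (A2): $0<s_\infty<L$. Assumption (A3): the setpoint $s_{\rm r}$ satisfies $s_\infty<s_{\rm r}<L$. *)

(* Defs.v *)
From Stdlib Require Import Reals List.
From Coquelicot Require Import Coquelicot.

(* Standard library reals with Coquelicot. *)

Open Scope R_scope.

Record material := Material {
  len : R;       (* L *)
  alpha_l : R;
  alpha_s : R;
  k_l : R;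
  k_s : R;
  gamma : R;     (* density times latent heat *)
  T_m : R;       (* melting temperature, of arbitrary sign *)
  len_pos : 0 < len;
  alpha_l_pos : 0 < alpha_l;
  alpha_s_pos : 0 < alpha_s;
  k_l_pos : 0 < k_l;
  k_s_pos : 0 < k_s;
  gamma_pos : 0 < gamma
}.

(* Temperatures are total functions of (x, t), of which only the restriction to
   the region occupied by the phase is meaningful; limits are therefore taken
   within a set. *)

Definition continuous_on_at {U V : UniformSpace} (D : U -> Prop) (f : U -> V)
    (x : U) : Prop :=
  filterlim f (within D (locally x)) (locally (f x)).

(* One-sided at an end point of an interval [D], ordinary inside it. *)
Definition is_derive_on (D : R -> Prop) (f : R -> R) (x l : R) : Prop :=
  filterlim (fun y => (f y - f x) / (y - x))
    (within D (locally' x)) (locally l).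

Definition piecewise_continuous (f : R -> R) (a b : R) : Prop :=
  exists D : list R, forall x, a <= x <= b ->
    (~ In x D -> continuous_on_at (fun y => a <= y <= b) f x) /\
    (a < x -> exists l : R, filterlim f (at_left x) (locally l)) /\
    (x < b -> exists l : R, filterlim f (at_right x) (locally l)).

Definition admissible_data (P : material) (Tl0 Ts0 : R -> R) (s0 : R) : Prop :=
  0 < s0 < len P /\
  piecewise_continuous Tl0 0 s0 /\
  piecewise_continuous Ts0 s0 (len P) /\
  exists Hl Hs : R, 0 < Hl /\ 0 < Hs /\
    (forall x, 0 <= x <= s0 -> T_m P <= Tl0 x <= T_m P + Hl * (s0 - x)) /\
    (forall x, s0 <= x <= len P -> T_m P + Hs * (s0 - x) <= Ts0 x <= T_m P).

Definition s_infty (P : material) (Tl0 Ts0 : R -> R) (s0 : R) : R :=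
  s0 + k_l P / (alpha_l P * gamma P) * RInt (fun x => Tl0 x - T_m P) 0 s0
     + k_s P / (alpha_s P * gamma P) * RInt (fun x => Ts0 x - T_m P) s0 (len P).

(* The phase lying between the curves [a] and [b], at the times in [I]. *)
Definition region (I : R -> Prop) (a b : R -> R) (p : R * R) : Prop :=
  0 <= snd p /\ I (snd p) /\ a (snd p) <= fst p <= b (snd p).

(* [T] is a classical solution of T_t = alpha T_xx between [a] and [b], with
   spatial derivatives [Tx], [Txx] and time derivative [Tt]. [T] and [Tx] are
   continuous up to the lateral boundary for t > 0. As [T0] is only piecewise
   continuous, [T] is continuous at (x, 0) when [T0] is continuous at x, and
   merely bounded near (x, 0) in general. *)
Record classical_heat (alpha : R) (I : R -> Prop) (a b : R -> R) (T0 : R -> R)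
    (T Tx Txx Tt : R -> R -> R) : Prop := {
  heat_dx : forall x t, 0 < t -> I t -> a t <= x <= b t ->
    is_derive_on (fun y => a t <= y <= b t) (fun y => T y t) x (Tx x t);
  heat_dxx : forall x t, 0 < t -> I t -> a t < x < b t ->
    is_derive (fun y => Tx y t) x (Txx x t);
  heat_dt : forall x t, 0 < t -> I t -> a t < x < b t ->
    is_derive (fun r => T x r) t (Tt x t);
  heat_cont : forall x t, 0 < t -> I t -> a t <= x <= b t ->
    continuous_on_at (region I a b)
      (fun p : R * R => T (fst p) (snd p)) (x, t);
  heat_cont_dx : forall x t, 0 < t -> I t -> a t <= x <= b t ->
    continuous_on_at (fun p => 0 < snd p /\ region I a b p)
      (fun p : R * R => Tx (fst p) (snd p)) (x, t);
  heat_cont_dxx : forall x t, 0 < t -> I t -> a t < x < b t ->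
    continuous (fun p : R * R => Txx (fst p) (snd p)) (x, t);
  heat_cont_dt : forall x t, 0 < t -> I t -> a t < x < b t ->
    continuous (fun p : R * R => Tt (fst p) (snd p)) (x, t);
  heat_eq : forall x t, 0 < t -> I t -> a t < x < b t ->
    Tt x t = alpha * Txx x t;
  heat_init : forall x, a 0 <= x <= b 0 -> T x 0 = T0 x;
  heat_init_cont : forall x, a 0 <= x <= b 0 ->
    continuous_on_at (fun y => a 0 <= y <= b 0) T0 x ->
    continuous_on_at (region I a b)
      (fun p : R * R => T (fst p) (snd p)) (x, 0);
  heat_init_bounded : forall x, a 0 <= x <= b 0 ->
    exists B : R, within (region I a b) (locally (x, 0))
      (fun p : R * R => Rabs (T (fst p) (snd p)) <= B)
}.

Definition two_phases (P : material) (s : R -> R) (t : R) : Prop :=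
  0 < s t < len P.

(* The equations are only meaningful while both phases are present, so they are
   imposed at the times t with 0 < s(t) < L. That this holds at all times is not
   part of the notion of solution: a priori [s] is any continuous function on
   [0, +oo), which may reach 0 or L. Continuity of the derivative of [s] follows
   from the interface condition. *)
Definition stefan_solution (P : material) (qc : R -> R)
    (Tl0 Ts0 : R -> R) (s0 : R) (Tl Ts : R -> R -> R) (s : R -> R) : Prop :=
  s 0 = s0 /\
  (forall t, 0 <= t -> continuous_on_at (fun r => 0 <= r) s t) /\
  exists Tlx Tlxx Tlt Tsx Tsxx Tst : R -> R -> R,
    classical_heat (alpha_l P) (two_phases P s) (fun _ => 0) s
      Tl0 Tl Tlx Tlxx Tlt /\
    classical_heat (alpha_s P) (two_phases P s) s (fun _ => len P)
      Ts0 Ts Tsx Tsxx Tst /\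
    forall t, 0 < t -> two_phases P s t ->
      Tlx 0 t = - (qc t / k_l P) /\
      Tsx (len P) t = 0 /\
      Tl (s t) t = T_m P /\
      Ts (s t) t = T_m P /\
      ex_derive s t /\
      gamma P * Derive s t = - k_l P * Tlx (s t) t + k_s P * Tsx (s t) t.

Definition feedback (P : material) (c sr : R) (Tl Ts : R -> R -> R)
    (s : R -> R) (t : R) : R :=
  - c * (k_l P / alpha_l P * RInt (fun x => Tl x t - T_m P) 0 (s t)
       + k_s P / alpha_s P * RInt (fun x => Ts x t - T_m P) (s t) (len P)
       + gamma P * (s t - sr)).

Definition Psi (P : material) (sr : R) (Tl Ts : R -> R -> R) (s : R -> R)
    (t : R) : R :=
  RInt (fun x => (Tl x t - T_m P) ^ 2) 0 (s t)
  + RInt (fun x => (Ts x t - T_m P) ^ 2) (s t) (len P)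
  + (s t - sr) ^ 2.

Definition decay_rate (P : material) (c : R) : R :=
  / 2 * Rmin (alpha_l P / (2 * len P ^ 2)) (Rmin (alpha_s P / len P ^ 2) c).

(* Main.v *)
(* Both phases are put in the form of a heat equation for a function u on
   [0 <= x <= sg t] vanishing at the moving end. For a C^2 function phi with
   phi 0 = 0, the integral of phi(u) has derivative
   alpha (phi'(0) u_x(sg,t) - phi'(u(0,t)) u_x(0,t) - int phi''(u) u_x^2),
   and it is continuous at t = 0 although the initial data are only piecewise
   continuous. Three choices of phi give the theorem. With phi(u) = u, the
   feedback law becomes q' = - c q, so the heat input is q(0) exp(- c t), which is
   positive because s_infty < sr. With phi vanishing exactly on [0, +oo), the
   signs of the temperatures follow. With phi(u) = u^2, Poincare's inequality
   gives the exponential decay of the two L^2 norms. The heat balance and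
   Cauchy-Schwarz then keep s away from 0 and from L up to any first exit time,
   and express s - sr through quantities that decay. Since s_infty <> sr, Psi(0)
   is positive, so a bound by a multiple of exp(- d t) is enough. *)

Require Import Defs.
From Stdlib Require Import Reals Lra List Classical.
From Coquelicot Require Import Coquelicot.

Open Scope R_scope.

(** * Integrals depending on a parameter *)

(** The obstacle is regularity at the edges. The second derivative is continuous only inside a
    phase, with no bound near the front or the fixed end, so the integral over a whole phase cannot
    be differentiated under the sign. The rate is therefore computed on the truncated phase from [e]
    to [sg t - e], where integration by parts leaves only [u] and [u_x]. These are continuous up to
    the lateral boundary, and [e] tends to 0 in an increment over a fixed time step. At time 0 no
    derivative is available: only continuity of the integrals is carried there, and monotonicity
    arguments start from small positive times. To turn one-sided regularity into ordinary continuity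
    on a neighbourhood, functions of a phase are extended constantly in [x] beyond its two ends, and
    time near 0 is read through [Rabs]. The equations hold only while 0 < s < L, so every estimate
    is made on an interval [0, tau) where this is known. There is no circularity: the constants come
    from the initial data and not from the distance of the front to the ends. *)

Definition cont2 (f : R -> R -> R) (x t : R) : Prop :=
  continuous (fun z : R * R => f (fst z) (snd z)) (x, t).

Lemma cont2_comp {T : UniformSpace} (f : R -> R -> R) (X Y : T -> R) (z : T) :
  cont2 f (X z) (Y z) -> continuous X z -> continuous Y z ->
  continuous (fun y => f (X y) (Y y)) z.
Proof.
intros Hf HX HY.
now apply (continuous_comp_2 X Y f).
Qed.

Lemma cont2_left (f : R -> R -> R) (x t : R) :
  cont2 f x t -> continuous (fun y => f y t) x.
Proof.
intros H; apply (cont2_comp f (fun y => y) (fun _ => t)); trivial.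
apply continuous_id.
apply continuous_const.
Qed.

Lemma continuous_eps {U : UniformSpace} (f : U -> R) (x : U) :
  continuous f x <-> forall eps, 0 < eps -> locally x (fun y => Rabs (f y - f x) < eps).
Proof.
unfold continuous; rewrite filterlim_locally; split.
- intros H eps He; exact (H (mkposreal eps He)).
- intros H eps; exact (H eps (cond_pos eps)).
Qed.

Lemma RInt_split (f : R -> R) (a b c : R) :
  ex_RInt f a b -> ex_RInt f b c -> RInt f a c = RInt f a b + RInt f b c.
Proof.
intros H1 H2; symmetry; exact (RInt_Chasles f a b c H1 H2).
Qed.

Lemma ex_RInt_cont (f : R -> R) (a b : R) :
  (forall x, continuous f x) -> ex_RInt f a b.
Proof.
intros H; apply (ex_RInt_continuous (V := R_CompleteNormedModule)); intros z _; apply H.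
Qed.

Lemma RInt_ext_R (f g : R -> R) (a b : R) :
  a <= b -> (forall x, a < x < b -> f x = g x) -> RInt f a b = RInt g a b.
Proof.
intros Hab H; apply (RInt_ext (V := R_CompleteNormedModule)).
now rewrite Rmin_left, Rmax_right.
Qed.

Lemma RInt_eq_zero (f : R -> R) (a b : R) :
  a <= b -> (forall x, a < x < b -> f x = 0) -> RInt f a b = 0.
Proof.
intros Hab H; rewrite (RInt_ext_R f (fun _ => 0)), RInt_const by trivial.
apply Rmult_0_r.
Qed.

Lemma ex_RInt_ext_R (f g : R -> R) (a b : R) :
  a <= b -> (forall x, a < x < b -> f x = g x) -> ex_RInt f a b -> ex_RInt g a b.
Proof.
intros Hab H; apply (ex_RInt_ext (V := R_NormedModule)).
now rewrite Rmin_left, Rmax_right.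
Qed.

Lemma RInt_minus_R (f g : R -> R) (a b : R) :
  ex_RInt f a b -> ex_RInt g a b ->
  RInt (fun x => f x - g x) a b = RInt f a b - RInt g a b.
Proof. exact (RInt_minus f g a b). Qed.

Lemma ex_RInt_minus_R (f g : R -> R) (a b : R) :
  ex_RInt f a b -> ex_RInt g a b -> ex_RInt (fun x => f x - g x) a b.
Proof. exact (ex_RInt_minus f g a b). Qed.

Lemma RInt_scal_R (f : R -> R) (k a b : R) :
  ex_RInt f a b -> RInt (fun x => k * f x) a b = k * RInt f a b.
Proof. exact (RInt_scal f a b k). Qed.

Lemma ex_RInt_scal_R (f : R -> R) (k a b : R) :
  ex_RInt f a b -> ex_RInt (fun x => k * f x) a b.
Proof. exact (ex_RInt_scal f a b k). Qed.

Lemma RInt_swap_R (f : R -> R) (a b : R) :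
  ex_RInt f a b -> RInt f b a = - RInt f a b.
Proof. intros H; symmetry; exact (opp_RInt_swap f a b H). Qed.

Lemma abs_RInt_le_gen (f : R -> R) (a b K : R) :
  ex_RInt f a b ->
  (forall x, Rmin a b <= x <= Rmax a b -> Rabs (f x) <= K) ->
  Rabs (RInt f a b) <= Rabs (b - a) * K.
Proof.
intros Hi HK.
destruct (Rle_dec a b) as [H|H].
- rewrite Rmin_left, Rmax_right in HK by lra.
  rewrite (Rabs_pos_eq (b - a)) by lra.
  now apply abs_RInt_le_const.
- rewrite Rmin_right, Rmax_left in HK by lra.
  apply ex_RInt_swap in Hi.
  rewrite (RInt_swap_R f b a Hi), Rabs_Ropp, Rabs_minus_sym, (Rabs_pos_eq (a - b)) by lra.
  apply abs_RInt_le_const; trivial; lra.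
Qed.

(** Compactness of [[a, b]] makes the joint continuity along the slice [t0] uniform in [x]. *)
Lemma cont2_uniform (g : R -> R -> R) (a b t0 eps : R) :
  (forall x, a <= x <= b -> cont2 g x t0) -> 0 < eps ->
  locally t0 (fun t => forall x, a <= x <= b -> Rabs (g x t - g x t0) < eps).
Proof.
intros Hg He.
destruct (uniform_continuity_2d_1d g a b t0
  (fun x Hx => proj2 (continuity_2d_pt_filterlim g x t0) (Hg x Hx)) (mkposreal eps He))
  as [d Hd].
exists d; intros t Ht x Hx.
assert (Rabs (t - t0) < d) by exact Ht.
apply Rabs_def2 in H.
pose proof (cond_pos d) as Hpos.
apply (Hd x t0 x t); try lra.
now rewrite Rminus_diag, Rabs_R0.
Qed.

Lemma continuous_bounded (f : R -> R) (a b : R) :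
  (forall x, continuous f x) ->
  exists K, 0 < K /\ forall x, a <= x <= b -> Rabs (f x) <= K.
Proof.
intros Hf.
destruct (Rle_dec a b) as [Hab|Hab].
- destruct (continuity_ab_maj (fun x => Rabs (f x)) a b Hab) as [m [Hm _]].
  + intros c _; apply continuity_pt_filterlim.
    apply (continuous_comp f Rabs); [apply Hf | apply continuous_Rabs].
  + exists (Rabs (f m) + 1); split.
    * pose proof (Rabs_pos (f m)); lra.
    * intros x Hx; specialize (Hm x Hx); lra.
- exists 1; split; [lra | intros x Hx; lra].
Qed.

Lemma continuous_RInt_bounds_param (g : R -> R -> R) (a0 b0 t0 : R) :
  locally t0 (fun t => forall x, cont2 g x t) ->
  continuous (fun z : R * R * R =>
    RInt (fun x => g x (snd z)) (fst (fst z)) (snd (fst z))) ((a0, b0), t0).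
Proof.
intros Hg.
pose proof (locally_singleton _ _ Hg) as Hg0.
(* A margin of 1 on each side: the perturbed bounds stay between [m] and [M] because the radius [d]
   below is at most 1. *)
set (m := Rmin a0 b0 - 1); set (M := Rmax a0 b0 + 1).
destruct (continuous_bounded (fun x => g x t0) m M) as [K [HK0 HK]].
{ intros x; now apply cont2_left. }
apply continuous_eps; intros eps He.
set (W := Rabs (b0 - a0) + 1).
assert (HW : 0 < W) by (unfold W; pose proof (Rabs_pos (b0 - a0)); lra).
set (e1 := Rmin 1 (eps / (4 * W))).
assert (He1 : 0 < e1).
{ apply Rmin_pos; [lra | apply Rdiv_lt_0_compat; lra]. }
destruct (cont2_uniform g m M t0 e1 (fun x _ => Hg0 x) He1) as [d1 Hd1].
destruct Hg as [d2 Hd2].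
set (d := Rmin (Rmin d1 d2) (Rmin 1 (eps / (4 * (K + 1))))).
assert (Hd : 0 < d).
{ repeat apply Rmin_pos; try apply cond_pos; try lra.
  apply Rdiv_lt_0_compat; lra. }
exists (mkposreal d Hd).
intros [[a b] t] [[Ha Hb] Ht]; simpl in *.
change (Rabs (a - a0) < d) in Ha; change (Rabs (b - b0) < d) in Hb;
change (Rabs (t - t0) < d) in Ht.
assert (Hdd : d <= d1 /\ d <= d2 /\ d <= 1 /\ d <= eps / (4 * (K + 1))).
{ unfold d; repeat split.
  - eapply Rle_trans; [apply Rmin_l | apply Rmin_l].
  - eapply Rle_trans; [apply Rmin_l | apply Rmin_r].
  - eapply Rle_trans; [apply Rmin_r | apply Rmin_l].
  - eapply Rle_trans; [apply Rmin_r | apply Rmin_r]. }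
destruct Hdd as (Hdd1 & Hdd2 & Hdd3 & Hdd4).
assert (Hgt : forall x, continuous (fun y => g y t) x).
{ intros x; apply cont2_left; apply Hd2.
  change (Rabs (t - t0) < d2); lra. }
assert (Hgt0 : forall x, continuous (fun y => g y t0) x).
{ intros x; now apply cont2_left. }
assert (Hclose : forall x, m <= x <= M -> Rabs (g x t - g x t0) < e1).
{ apply Hd1. change (Rabs (t - t0) < d1); lra. }
assert (Hbd : forall x, m <= x <= M -> Rabs (g x t) <= K + 1).
{ intros x Hx. specialize (Hclose x Hx). specialize (HK x Hx).
  assert (e1 <= 1) by apply Rmin_l.
  replace (g x t) with ((g x t - g x t0) + g x t0) by ring.
  eapply Rle_trans; [apply Rabs_triang |]; lra. }
(* Two short integrals near the bounds, small because the integrand is at most [K + 1], and one over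
   the fixed interval, small by uniform closeness; each is at most [eps / 4]. *)
rewrite (RInt_split _ a a0 b) by now apply ex_RInt_cont.
rewrite (RInt_split _ a0 b0 b) by now apply ex_RInt_cont.
replace (RInt (fun x => g x t) a a0 + (RInt (fun x => g x t) a0 b0 + RInt (fun x => g x t) b0 b)
  - RInt (fun x => g x t0) a0 b0) with
  (RInt (fun x => g x t) a a0 + RInt (fun x => g x t) b0 b
   + RInt (fun x => g x t - g x t0) a0 b0)
  by (rewrite RInt_minus_R by (now apply ex_RInt_cont); ring).
assert (HK4 : eps / (4 * (K + 1)) * (K + 1) = eps / 4) by (field; lra).
assert (HW4 : eps / (4 * W) * W = eps / 4) by (field; lra).
apply Rabs_def2 in Ha; apply Rabs_def2 in Hb.
assert (B1 : Rabs (RInt (fun x => g x t) a a0) <= Rabs (a0 - a) * (K + 1)).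
{ apply abs_RInt_le_gen; [now apply ex_RInt_cont |].
  intros x Hx; apply Hbd; unfold m, M.
  revert Hx; unfold Rmin, Rmax; repeat destruct Rle_dec; lra. }
assert (B2 : Rabs (RInt (fun x => g x t) b0 b) <= Rabs (b - b0) * (K + 1)).
{ apply abs_RInt_le_gen; [now apply ex_RInt_cont |].
  intros x Hx; apply Hbd; unfold m, M.
  revert Hx; unfold Rmin, Rmax; repeat destruct Rle_dec; lra. }
assert (B3 : Rabs (RInt (fun x => g x t - g x t0) a0 b0) <= Rabs (b0 - a0) * e1).
{ apply abs_RInt_le_gen.
  - apply ex_RInt_minus_R; now apply ex_RInt_cont.
  - intros x Hx; left; apply Hclose; unfold m, M; lra. }
assert (C1 : Rabs (a0 - a) * (K + 1) <= eps / 4).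
{ rewrite <- HK4; apply Rmult_le_compat_r; [lra|].
  apply Rabs_le; lra. }
assert (C2 : Rabs (b - b0) * (K + 1) <= eps / 4).
{ rewrite <- HK4; apply Rmult_le_compat_r; [lra|].
  apply Rabs_le; lra. }
assert (C3 : Rabs (b0 - a0) * e1 <= eps / 4).
{ rewrite <- HW4, (Rmult_comm _ W); apply Rmult_le_compat; try apply Rabs_pos; try lra.
  - unfold W; lra.
  - apply Rmin_r. }
eapply Rle_lt_trans; [apply Rabs_triang |].
eapply Rle_lt_trans; [apply Rplus_le_compat_r, Rabs_triang |].
lra.
Qed.

Lemma is_derive_RInt_upper (g : R -> R) (a x : R) :
  (forall y, continuous g y) -> is_derive (fun y => RInt g a y) x (g x).
Proof.
intros Hg; apply (is_derive_RInt g _ a); [| apply Hg].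
apply filter_forall; intros y; apply (RInt_correct g a y).
now apply ex_RInt_cont.
Qed.

(** The difference of [f] and the primitive of [g] has zero derivative inside. No derivative is
    asked at the end points, because an extended temperature may have a kink at the front and at the
    fixed end. *)
Lemma fundamental_theorem_interior (f g : R -> R) (a b : R) :
  a <= b -> (forall x, continuous f x) -> (forall x, continuous g x) ->
  (forall x, a < x < b -> is_derive f x (g x)) ->
  RInt g a b = f b - f a.
Proof.
intros Hab Hf Hg Hd.
destruct (MVT_gen (fun x => f x - RInt g a x) a b (fun _ => 0)) as [c [_ Hc]].
- rewrite Rmin_left, Rmax_right by lra; intros x Hx.
  replace 0 with (g x - g x) by ring.
  apply (is_derive_minus f (fun y => RInt g a y)); [now apply Hd|].
  now apply is_derive_RInt_upper.
- intros x _. apply continuity_pt_filterlim.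
  apply (continuous_minus f (fun y => RInt g a y)); [apply Hf|].
  apply (ex_derive_continuous (fun y => RInt g a y)); exists (g x).
  now apply is_derive_RInt_upper.
- assert (RInt g a a = 0) by exact (RInt_point a g).
  lra.
Qed.

Lemma RInt_square (f : R -> R) (a b : R) :
  a <= b -> ex_RInt f a b -> ex_RInt (fun x => f x ^ 2) a b ->
  RInt f a b ^ 2 <= (b - a) * RInt (fun x => f x ^ 2) a b.
Proof.
intros Hab Hf Hf2.
destruct (Req_dec a b) as [->|Hne].
{ assert (RInt f b b = 0) by exact (RInt_point b f). rewrite H; nra. }
set (I := RInt f a b); set (J := RInt (fun x => f x ^ 2) a b).
(* [l] is the mean value of [f]; the inequality is the nonnegativity of the integral of
   [(f - l) ^ 2], expanded. *)
set (l := I / (b - a)).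
assert (Hl : l * (b - a) = I) by (unfold l; field; lra).
assert (0 <= RInt (fun x => f x ^ 2 - (2 * l * f x - l ^ 2)) a b).
{ apply RInt_ge_0; trivial.
  - apply ex_RInt_minus_R; trivial.
    apply ex_RInt_minus_R; [now apply ex_RInt_scal_R | apply ex_RInt_const].
  - intros x _; pose proof (pow2_ge_0 (f x - l)); nra. }
rewrite RInt_minus_R in H; trivial.
2:{ apply ex_RInt_minus_R; [now apply ex_RInt_scal_R | apply ex_RInt_const]. }
rewrite RInt_minus_R in H; [| now apply ex_RInt_scal_R | apply ex_RInt_const].
rewrite RInt_scal_R in H; trivial.
rewrite RInt_const in H.
change (scal (b - a) (l ^ 2)) with ((b - a) * l ^ 2) in H.
fold I J in H; rewrite <- Hl in H |- *.
apply (Rmult_le_compat_l (b - a)) in H; lra.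
Qed.

Lemma ex_RInt_one_sided (f : R -> R) (a b la lb : R) :
  a < b -> (forall x, a < x < b -> continuous f x) ->
  filterlim f (at_right a) (locally la) -> filterlim f (at_left b) (locally lb) ->
  ex_RInt f a b.
Proof.
intros Hab Hf Ha Hb.
destruct (C0_extension_lt f la lb a b Hab Hf Ha Hb) as [g [Hg [Hgf _]]].
apply (ex_RInt_ext (V := R_NormedModule) g).
- rewrite Rmin_left, Rmax_right by lra; exact Hgf.
- apply ex_RInt_cont; exact Hg.
Qed.

Lemma locally_pair_R (x t : R) (P : R * R -> Prop) :
  locally (x, t) P <->
  exists r, 0 < r /\ forall y q, Rabs (y - x) < r -> Rabs (q - t) < r -> P (y, q).
Proof.
split.
- intros [d Hd]; exists d; split; [apply cond_pos|].
  intros y q Hy Hq; apply Hd; split; assumption.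
- intros [d [Hd H]]; exists (mkposreal d Hd); intros [y q] [Hy Hq]; now apply H.
Qed.

(* The integrand need not converge at the two end points, but it is bounded
   there: the integrals over small intervals at the ends are negligible, and
   the convergence is uniform in between. *)
Lemma RInt_param_continuous_interior (g : R -> R -> R) (a b la lb : R) :
  a < b ->
  locally 0 (fun t => t <> 0 -> forall x, continuous (fun y => g y t) x) ->
  (forall x, a <= x <= b -> exists B, locally (x, 0) (fun z => Rabs (g (fst z) (snd z)) <= B)) ->
  (forall x, a < x < b -> cont2 g x 0) ->
  filterlim (fun x => g x 0) (at_right a) (locally la) ->
  filterlim (fun x => g x 0) (at_left b) (locally lb) ->
  continuous (fun t => RInt (fun x => g x t) a b) 0.
Proof.
intros Hab Hc Hb Hg Hla Hlb.
assert (Hi0 : ex_RInt (fun x => g x 0) a b).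
{ apply (ex_RInt_one_sided _ a b la lb); trivial.
  intros x Hx; apply cont2_left; now apply Hg. }
destruct (Hb a ltac:(lra)) as [Ba HBa]; destruct (Hb b ltac:(lra)) as [Bb HBb].
apply locally_pair_R in HBa; apply locally_pair_R in HBb.
destruct HBa as [ra [Hra HBa]]; destruct HBb as [rb [Hrb HBb]]; simpl in *.
apply continuous_eps; intros eps He.
set (B := Rabs Ba + Rabs Bb + 1).
assert (HB : 0 < B).
{ unfold B; pose proof (Rabs_pos Ba); pose proof (Rabs_pos Bb); lra. }
assert (HB' : Ba <= B /\ Bb <= B).
{ unfold B; pose proof (Rabs_pos Ba); pose proof (Rabs_pos Bb).
  pose proof (Rle_abs Ba); pose proof (Rle_abs Bb); lra. }
set (h := Rmin (Rmin (ra / 2) (rb / 2)) (Rmin ((b - a) / 3) (eps / (8 * B)))).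
assert (Hh : 0 < h).
{ repeat apply Rmin_pos; try lra; apply Rdiv_lt_0_compat; lra. }
assert (Hhh : h <= ra / 2 /\ h <= rb / 2 /\ h <= (b - a) / 3 /\ h <= eps / (8 * B)).
{ unfold h; repeat split.
  - eapply Rle_trans; [apply Rmin_l | apply Rmin_l].
  - eapply Rle_trans; [apply Rmin_l | apply Rmin_r].
  - eapply Rle_trans; [apply Rmin_r | apply Rmin_l].
  - eapply Rle_trans; [apply Rmin_r | apply Rmin_r]. }
destruct Hhh as (Hh1 & Hh2 & Hh3 & Hh4).
assert (HhB : h * B <= eps / 8).
{ replace (eps / 8) with (eps / (8 * B) * B) by (field; lra).
  apply Rmult_le_compat_r; lra. }
assert (Hmid : locally 0 (fun t => forall x, a + h <= x <= b - h ->
   Rabs (g x t - g x 0) < eps / (4 * (b - a)))).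
{ apply cont2_uniform; [intros x Hx; apply Hg; lra | apply Rdiv_lt_0_compat; lra]. }
assert (Hr : locally 0 (fun t => Rabs t < Rmin ra rb)).
{ exists (mkposreal _ (Rmin_pos _ _ Hra Hrb)); intros t Ht.
  change (Rabs (t - 0) < Rmin ra rb) in Ht; now rewrite Rminus_0_r in Ht. }
generalize (filter_and _ _ Hc (filter_and _ _ Hmid Hr)); apply filter_imp.
intros t (Hct & Hmt & Hrt).
assert (Hit : ex_RInt (fun x => g x t) a b).
{ destruct (Req_dec t 0) as [->|Ht]; trivial.
  apply ex_RInt_cont; now apply Hct. }
pose proof (Rmin_l ra rb); pose proof (Rmin_r ra rb).
assert (Hbt : forall q x, Rabs q < Rmin ra rb -> (a <= x <= a + h \/ b - h <= x <= b) ->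
  Rabs (g x q) <= B).
{ intros q x Hq [Hx|Hx].
  - apply Rle_trans with Ba; [| lra]. apply HBa; [apply Rabs_def1; lra |].
    rewrite Rminus_0_r; lra.
  - apply Rle_trans with Bb; [| lra]. apply HBb; [apply Rabs_def1; lra |].
    rewrite Rminus_0_r; lra. }
assert (H0r : Rabs 0 < Rmin ra rb) by (rewrite Rabs_R0; now apply Rmin_pos).
set (d := fun x => g x t - g x 0).
assert (Hd : ex_RInt d a b) by now apply ex_RInt_minus_R.
assert (Hd1 : ex_RInt d a (a + h)).
{ apply (ex_RInt_Chasles_1 (V := R_CompleteNormedModule) d a (a + h) b); [lra | trivial]. }
assert (Hd1' : ex_RInt d (a + h) b).
{ apply (ex_RInt_Chasles_2 (V := R_CompleteNormedModule) d a (a + h) b); [lra | trivial]. }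
assert (Hd2 : ex_RInt d (a + h) (b - h)).
{ apply (ex_RInt_Chasles_1 (V := R_CompleteNormedModule) d (a + h) (b - h) b); [lra | trivial]. }
assert (Hd3 : ex_RInt d (b - h) b).
{ apply (ex_RInt_Chasles_2 (V := R_CompleteNormedModule) d (a + h) (b - h) b); [lra | trivial]. }
rewrite <- RInt_minus_R by trivial; fold d.
rewrite (RInt_split d a (a + h) b), (RInt_split d (a + h) (b - h) b) by trivial.
assert (Hend : forall x, (a <= x <= a + h \/ b - h <= x <= b) -> Rabs (d x) <= 2 * B).
{ intros x Hx; unfold d.
  pose proof (Hbt t x Hrt Hx); pose proof (Hbt 0 x H0r Hx).
  unfold Rminus; eapply Rle_trans; [apply Rabs_triang|]; rewrite Rabs_Ropp; lra. }
assert (E1 : Rabs (RInt d a (a + h)) <= (a + h - a) * (2 * B)).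
{ apply abs_RInt_le_const; trivial; [lra | intros x Hx; apply Hend; now left]. }
assert (E3 : Rabs (RInt d (b - h) b) <= (b - (b - h)) * (2 * B)).
{ apply abs_RInt_le_const; trivial; [lra | intros x Hx; apply Hend; now right]. }
assert (E2 : Rabs (RInt d (a + h) (b - h)) <= (b - h - (a + h)) * (eps / (4 * (b - a)))).
{ apply abs_RInt_le_const; trivial; [lra | intros x Hx; left; now apply Hmt]. }
assert ((b - h - (a + h)) * (eps / (4 * (b - a))) <= eps / 4).
{ replace (eps / 4) with ((b - a) * (eps / (4 * (b - a)))) by (field; lra).
  apply Rmult_le_compat_r; [left; apply Rdiv_lt_0_compat; lra | lra]. }
eapply Rle_lt_trans; [apply Rabs_triang |].
eapply Rle_lt_trans; [apply Rplus_le_compat_l, Rabs_triang |].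
lra.
Qed.

(** Induction on the exceptional points: one lying inside the interval cuts it in two, and becomes
    an end point of both halves, where boundedness and a one-sided limit suffice. One lying
    elsewhere is dropped. *)
Lemma RInt_param_continuous_piecewise (g : R -> R -> R) (D : list R) (a b : R) :
  a <= b ->
  locally 0 (fun t => t <> 0 -> forall x, continuous (fun y => g y t) x) ->
  (forall x, a <= x <= b -> exists B, locally (x, 0) (fun z => Rabs (g (fst z) (snd z)) <= B)) ->
  (forall x, a < x < b -> ~ In x D -> cont2 g x 0) ->
  (forall x, a < x <= b -> exists l, filterlim (fun x => g x 0) (at_left x) (locally l)) ->
  (forall x, a <= x < b -> exists l, filterlim (fun x => g x 0) (at_right x) (locally l)) ->
  ex_RInt (fun x => g x 0) a b /\ continuous (fun t => RInt (fun x => g x t) a b) 0.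
Proof.
intros Hab Hc; revert a b Hab; induction D as [|d D IH]; intros a b Hab Hb Hg Hl Hr.
- destruct (Req_dec a b) as [<-|Hne].
  + split; [apply ex_RInt_point |].
    apply (continuous_ext (fun _ => 0)); [| apply continuous_const].
    intros t; symmetry; exact (RInt_point a (fun x => g x t)).
  + destruct (Hl b) as [lb Hlb]; [lra|]; destruct (Hr a) as [la Hla]; [lra|].
    assert (Hg' : forall x, a < x < b -> cont2 g x 0) by (intros x Hx; now apply Hg).
    split.
    * apply (ex_RInt_one_sided _ a b la lb); trivial; [lra|].
      intros x Hx; apply cont2_left; now apply Hg'.
    * apply (RInt_param_continuous_interior g a b la lb); trivial; lra.
- destruct (classic (a < d < b)) as [Hd|Hd].
  + destruct (IH a d) as [I1 C1]; try lra.
    * intros x Hx; apply Hb; lra.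
    * intros x Hx HD; apply Hg; [lra|]; intros [E|E]; [lra | contradiction].
    * intros x Hx; apply Hl; lra.
    * intros x Hx; apply Hr; lra.
    * destruct (IH d b) as [I2 C2]; try lra.
      { intros x Hx; apply Hb; lra. }
      { intros x Hx HD; apply Hg; [lra|]; intros [E|E]; [lra | contradiction]. }
      { intros x Hx; apply Hl; lra. }
      { intros x Hx; apply Hr; lra. }
      split; [now apply (ex_RInt_Chasles (V := R_NormedModule) _ a d b)|].
      apply (continuous_ext_loc _ (fun t => RInt (fun x => g x t) a d + RInt (fun x => g x t) d b)).
      { generalize Hc; apply filter_imp; intros t Ht.
        symmetry; destruct (Req_dec t 0) as [->|Hne]; [now apply RInt_split|].
        apply RInt_split; apply ex_RInt_cont; now apply Ht. }
      apply (continuous_plus (fun t => RInt (fun x => g x t) a d)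
        (fun t => RInt (fun x => g x t) d b)); trivial.
  + apply IH; trivial.
    intros x Hx HD; apply Hg; trivial.
    intros [->|E]; contradiction.
Qed.

(** * Energy identity in a phase *)

(* The temperature [u] of a phase occupying [0 <= x <= sg t], relative to
   melting and counted positive, with [u = 0] for [sg t <= x]. [u] and [p], which
   is the space derivative inside the phase, are defined and continuous for all
   real [x]. *)
Record phase (alpha L tau : R) (sg dsg : R -> R) (u p uxx : R -> R -> R) : Prop := {
  ph_front : forall t, 0 <= t < tau -> 0 < sg t < L;
  ph_front_derive : forall t, 0 < t < tau -> is_derive sg t (dsg t);
  ph_front_cont : forall t, 0 < t < tau -> continuous dsg t;
  ph_cont : forall x t, 0 < t < tau -> cont2 u x t;
  ph_cont_dx : forall x t, 0 < t < tau -> cont2 p x t;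
  ph_zero : forall x t, 0 <= t < tau -> sg t <= x -> u x t = 0;
  ph_dx : forall x t, 0 < t < tau -> 0 < x < sg t ->
    is_derive (fun y => u y t) x (p x t);
  ph_dxx : forall x t, 0 < t < tau -> 0 < x < sg t ->
    is_derive (fun y => p y t) x (uxx x t);
  ph_dt : forall x t, 0 < t < tau -> 0 < x < sg t ->
    is_derive (fun r => u x r) t (alpha * uxx x t);
  ph_cont_dxx : forall x t, 0 < t < tau -> 0 < x < sg t -> cont2 uxx x t;
  ph_bounded : forall x, 0 <= x <= L -> exists B,
    locally (x, 0) (fun z : R * R => Rabs (u (fst z) (Rabs (snd z))) <= B);
  ph_init : exists D : list R, forall x, 0 < x < L -> ~ In x D ->
    cont2 (fun y t => u y (Rabs t)) x 0;
  ph_left : forall x, 0 < x <= L ->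
    exists l, filterlim (fun y => u y 0) (at_left x) (locally l);
  ph_right : forall x, 0 <= x < L ->
    exists l, filterlim (fun y => u y 0) (at_right x) (locally l)
}.

Lemma locally_open_interval (a b t : R) : a < t < b -> locally t (fun r => a < r < b).
Proof.
intros Ht; apply filter_and.
- now apply (open_gt a).
- now apply (open_lt b).
Qed.

Lemma locally_fst_R (x t : R) (P : R -> Prop) :
  locally x P -> locally (x, t) (fun z => P (fst z)).
Proof. apply (continuous_fst x t P). Qed.

Lemma locally_snd_R (x t : R) (P : R -> Prop) :
  locally t P -> locally (x, t) (fun z => P (snd z)).
Proof. apply (continuous_snd x t P). Qed.

Lemma ph_front_continuous {alpha L tau : R} {sg dsg : R -> R} {u p uxx : R -> R -> R} :
  phase alpha L tau sg dsg u p uxx ->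
  forall t, 0 < t < tau -> continuous sg t.
Proof.
intros ph t Ht; apply (ex_derive_continuous sg); exists (dsg t).
now apply (ph_front_derive _ _ _ _ _ _ _ _ ph).
Qed.

Lemma continuous_positive {U : UniformSpace} (f : U -> R) (z : U) :
  continuous f z -> 0 < f z -> locally z (fun y => 0 < f y).
Proof. intros Hf Hz; exact (Hf _ (open_gt 0 _ Hz)). Qed.

Lemma ph_interior_open {alpha L tau : R} {sg dsg : R -> R} {u p uxx : R -> R -> R} :
  phase alpha L tau sg dsg u p uxx ->
  forall x t, 0 < t < tau -> 0 < x < sg t ->
  locally (x, t) (fun z : R * R => 0 < snd z < tau /\ 0 < fst z < sg (snd z)).
Proof.
intros ph x t Ht Hx.
apply filter_and; [now apply (locally_snd_R x t (fun r => 0 < r < tau)), locally_open_interval|].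
apply filter_and; [apply (locally_fst_R x t (fun y => 0 < y)), (open_gt 0), Hx|].
apply filter_imp with (fun z : R * R => 0 < sg (snd z) - fst z).
{ intros z Hz; lra. }
apply (continuous_positive (fun z : R * R => sg (snd z) - fst z)); [| simpl; lra].
apply (continuous_minus (fun z : R * R => sg (snd z)) fst); [| apply continuous_fst].
apply (continuous_comp snd sg); [apply continuous_snd|].
now apply (ph_front_continuous ph).
Qed.

Lemma Rabs_le_limit (F : R -> R) (c K : R) :
  0 < c -> continuous F 0 -> (forall e, 0 < e < c -> Rabs (F e) <= K) -> Rabs (F 0) <= K.
Proof.
intros Hc HF HK.
destruct (Rle_or_lt (Rabs (F 0)) K) as [H|H]; trivial; exfalso.
assert (HaF : continuous (fun e => Rabs (F e) - K) 0).
{ apply (continuous_minus (fun e => Rabs (F e)) (fun _ => K)); [| apply continuous_const].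
  apply (continuous_comp F Rabs); [exact HF | apply continuous_Rabs]. }
destruct (continuous_positive _ _ HaF) as [d Hd]; [lra|].
set (e := Rmin (d / 2) (c / 2)).
pose proof (cond_pos d).
assert (He : 0 < e) by (apply Rmin_pos; lra).
assert (e <= d / 2) by apply Rmin_l.
assert (e <= c / 2) by apply Rmin_r.
specialize (HK e ltac:(lra)).
assert (Hb : 0 < Rabs (F e) - K); [| lra].
apply Hd; change (Rabs (e - 0) < d); rewrite Rminus_0_r, Rabs_pos_eq; lra.
Qed.

Lemma C2_continuous (phi phi1 phi2 : R -> R) :
  (forall v, is_derive phi v (phi1 v)) -> (forall v, is_derive phi1 v (phi2 v)) ->
  (forall v, continuous phi v) /\ (forall v, continuous phi1 v).
Proof.
intros H H1; split; intros v.
- apply (ex_derive_continuous phi); now exists (phi1 v).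
- apply (ex_derive_continuous phi1); now exists (phi2 v).
Qed.

Lemma cont2_outer (f : R -> R) (u : R -> R -> R) (x t : R) :
  (forall v, continuous f v) -> cont2 u x t -> cont2 (fun y r => f (u y r)) x t.
Proof.
intros Hf Hu; apply (continuous_comp (fun z : R * R => u (fst z) (snd z)) f); trivial.
Qed.

Lemma cont2_mult (f g : R -> R -> R) (x t : R) :
  cont2 f x t -> cont2 g x t -> cont2 (fun y r => f y r * g y r) x t.
Proof.
exact (continuous_mult (fun z : R * R => f (fst z) (snd z)) (fun z => g (fst z) (snd z)) (x, t)).
Qed.

Lemma cont2_swap (f : R -> R -> R) (x t : R) :
  cont2 f x t -> continuity_2d_pt (fun r y => f y r) t x.
Proof.
intros H; apply continuity_2d_pt_filterlim.
apply (cont2_comp f snd fst (t, x)); [exact H | apply continuous_snd | apply continuous_fst].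
Qed.

(** Rate of change of the integral of [phi u] over the truncated phase from [e] to [sg t - e], after
    integration by parts. The last term is the transport by the moving end; at [e = 0] it vanishes
    when [phi 0 = 0], as [u] is zero at the front. *)
Definition flux_rate (alpha : R) (sg dsg : R -> R) (u p : R -> R -> R)
    (phi phi1 phi2 : R -> R) (e t : R) : R :=
  alpha * (phi1 (u (sg t - e) t) * p (sg t - e) t - phi1 (u e t) * p e t
    - RInt (fun x => phi2 (u x t) * p x t ^ 2) e (sg t - e))
  + phi (u (sg t - e) t) * dsg t.

(** For [e > 0] the closed truncated interval lies inside the phase, where the time derivative is
    jointly continuous, so Leibniz's rule with a moving upper bound applies. *)
Lemma truncated_energy_derive {alpha L tau : R} {sg dsg : R -> R} {u p uxx : R -> R -> R}
    (ph : phase alpha L tau sg dsg u p uxx) (phi phi1 phi2 : R -> R) :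
  (forall v, is_derive phi v (phi1 v)) -> (forall v, is_derive phi1 v (phi2 v)) ->
  (forall v, continuous phi2 v) ->
  forall e t, 0 < t < tau -> 0 < e < sg t - e ->
  is_derive (fun r => RInt (fun x => phi (u x r)) e (sg r - e)) t
    (flux_rate alpha sg dsg u p phi phi1 phi2 e t).
Proof.
intros H H1 H2c e t Ht He.
destruct (C2_continuous phi phi1 phi2 H H1) as [Hc H1c].
assert (HD : forall x r, 0 < r < tau -> 0 < x < sg r ->
  is_derive (fun z => phi (u x z)) r (phi1 (u x r) * (alpha * uxx x r))).
{ intros x r Hr Hx.
  rewrite Rmult_comm.
  apply (is_derive_comp phi (fun z => u x z)); [apply H|].
  now apply (ph_dt _ _ _ _ _ _ _ _ ph). }
assert (HDc : forall x r, 0 < r < tau -> 0 < x < sg r ->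
  continuity_2d_pt (fun r' y => Derive (fun z => phi (u y z)) r') r x).
{ intros x r Hr Hx.
  apply (cont2_swap (fun y r' => Derive (fun z => phi (u y z)) r')).
  apply (continuous_ext_loc _ (fun z : R * R => phi1 (u (fst z) (snd z)) * (alpha * uxx (fst z) (snd z)))).
  { generalize (ph_interior_open ph x r Hr Hx); apply filter_imp; intros z [Hz1 Hz2].
    symmetry; apply is_derive_unique; now apply HD. }
  apply (cont2_mult (fun y r => phi1 (u y r)) (fun y r => alpha * uxx y r)).
  - apply (cont2_outer phi1); trivial; now apply (ph_cont _ _ _ _ _ _ _ _ ph).
  - apply (cont2_mult (fun _ _ => alpha) uxx); [apply continuous_const|].
    now apply (ph_cont_dxx _ _ _ _ _ _ _ _ ph). }
assert (HWc : forall r x, 0 < r < tau -> continuous (fun y => phi (u y r)) x).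
{ intros r x Hr; apply (cont2_left (fun y r => phi (u y r))); apply cont2_outer; trivial.
  now apply (ph_cont _ _ _ _ _ _ _ _ ph). }
assert (HWi : forall a b, locally t (fun r => ex_RInt (fun x => phi (u x r)) a b)).
{ intros a b; generalize (locally_open_interval 0 tau t Ht); apply filter_imp.
  intros r Hr; apply ex_RInt_cont; intros x; now apply HWc. }
set (b := sg t - e).
(* By the heat equation the integrand is [alpha * phi1(u) * uxx], and [phi1(u) * uxx] is the
   derivative of [phi1(u) * p] minus [phi2(u) * p ^ 2]. *)
assert (Hibp : RInt (fun x => Derive (fun z => phi (u x z)) t) e b =
  alpha * (phi1 (u b t) * p b t - phi1 (u e t) * p e t
    - RInt (fun x => phi2 (u x t) * p x t ^ 2) e b)).
{ transitivity (RInt (fun x => alpha * ((phi2 (u x t) * p x t * p x t + phi1 (u x t) * uxx x t)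
     - phi2 (u x t) * p x t ^ 2)) e b).
  { apply RInt_ext_R; [unfold b; lra | intros x Hx].
    replace (Derive (fun z => phi (u x z)) t) with (phi1 (u x t) * (alpha * uxx x t)); [ring|].
    symmetry; apply is_derive_unique; apply HD; unfold b in *; lra. }
  assert (Hut : forall x, continuous (fun y => u y t) x).
  { intros x; apply cont2_left; now apply (ph_cont _ _ _ _ _ _ _ _ ph). }
  assert (Hpt : forall x, continuous (fun y => p y t) x).
  { intros x; apply cont2_left; now apply (ph_cont_dx _ _ _ _ _ _ _ _ ph). }
  assert (H2u : forall x, continuous (fun y => phi2 (u y t)) x).
  { intros x; apply (continuous_comp (fun y => u y t) phi2); trivial. }
  assert (H2p : forall x, continuous (fun y => phi2 (u y t) * p y t) x).
  { intros x; apply (continuous_mult (fun y => phi2 (u y t)) (fun y => p y t)); trivial. }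
  assert (HI : is_RInt (fun x => phi2 (u x t) * p x t * p x t + phi1 (u x t) * uxx x t) e b
     (phi1 (u b t) * p b t - phi1 (u e t) * p e t)).
  { apply (is_RInt_derive (fun x => phi1 (u x t) * p x t)).
    - rewrite Rmin_left, Rmax_right by (unfold b; lra); intros x Hx.
      assert (Hx' : 0 < x < sg t) by (unfold b in *; lra).
      apply (is_derive_mult (fun x => phi1 (u x t)) (fun x => p x t) x).
      + rewrite Rmult_comm.
        apply (is_derive_comp phi1 (fun y => u y t)); [apply H1|].
        now apply (ph_dx _ _ _ _ _ _ _ _ ph).
      + now apply (ph_dxx _ _ _ _ _ _ _ _ ph).
      + exact Rmult_comm.
    - rewrite Rmin_left, Rmax_right by (unfold b; lra); intros x Hx.
      assert (Hx' : 0 < x < sg t) by (unfold b in *; lra).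
      apply (continuous_plus (fun x => phi2 (u x t) * p x t * p x t) (fun x => phi1 (u x t) * uxx x t)).
      + apply (continuous_mult (fun x => phi2 (u x t) * p x t) (fun x => p x t)); trivial.
      + apply (continuous_mult (fun x => phi1 (u x t)) (fun x => uxx x t)).
        * apply (continuous_comp (fun y => u y t) phi1); trivial.
        * apply cont2_left; now apply (ph_cont_dxx _ _ _ _ _ _ _ _ ph). }
  assert (HI2 : ex_RInt (fun x => phi2 (u x t) * p x t ^ 2) e b).
  { apply (ex_RInt_ext_R (fun x => phi2 (u x t) * p x t * p x t)); [unfold b; lra | |].
    - intros x _; ring.
    - apply ex_RInt_cont; intros x.
      apply (continuous_mult (fun x => phi2 (u x t) * p x t) (fun x => p x t)); trivial. }
  rewrite RInt_scal_R; [f_equal; rewrite RInt_minus_R; trivial|].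
  - now rewrite (is_RInt_unique _ _ _ _ HI).
  - eexists; exact HI.
  - apply ex_RInt_minus_R; trivial; eexists; exact HI. }
unfold flux_rate; fold b; rewrite <- Hibp.
replace (RInt (fun x => Derive (fun z => phi (u x z)) t) e b + phi (u b t) * dsg t) with
  (RInt (fun x => Derive (fun z => phi (u x z)) t) e b + - phi (u e t) * 0 + phi (u b t) * dsg t)
  by ring.
apply (is_derive_RInt_param_bound_comp (fun r x => phi (u x r)) (fun _ => e) (fun r => sg r - e) t 0 (dsg t)).
- apply HWi.
- exists (mkposreal 1 Rlt_0_1); apply HWi.
- exists (mkposreal 1 Rlt_0_1); apply HWi.
- apply (is_derive_const e t).
- replace (dsg t) with (dsg t - 0) by ring.
  apply (is_derive_minus sg (fun _ => e) t); [now apply (ph_front_derive _ _ _ _ _ _ _ _ ph)|].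
  apply (is_derive_const e t).
(* Enlarged by [e / 2], the interval runs from [e / 2] to [sg t - e / 2], and the front exceeds the
   latter at times close to [t]. *)
- assert (He2 : 0 < e / 2) by lra.
  exists (mkposreal _ He2); simpl.
  assert (Hsg : locally t (fun r => sg t - e / 2 < sg r)).
  { apply (ph_front_continuous ph t Ht), (open_gt (sg t - e / 2)); lra. }
  generalize (filter_and _ _ Hsg (locally_open_interval 0 tau t Ht)).
  apply filter_imp; intros r [Hr1 Hr2] x Hx.
  rewrite Rmin_left, Rmax_right in Hx by (fold b; unfold b; lra).
  eexists; apply HD; [trivial | lra].
- intros x Hx; apply HDc; trivial.
  rewrite Rmin_left, Rmax_right in Hx by (fold b; unfold b; lra); lra.
- apply locally_2d_locally, (locally_pair_R t e).
  destruct (proj1 (locally_pair_R e t _) (ph_interior_open ph e t Ht ltac:(lra))) as [r [Hr Hin]].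
  exists r; split; trivial; intros y q Hy Hq; simpl; apply HDc; now apply (Hin q y).
- apply locally_2d_locally, (locally_pair_R t (sg t - e)).
  destruct (proj1 (locally_pair_R (sg t - e) t _)
    (ph_interior_open ph (sg t - e) t Ht ltac:(lra))) as [r [Hr Hin]].
  exists r; split; trivial; intros y q Hy Hq; simpl; apply HDc; now apply (Hin q y).
- apply continuity_pt_filterlim; now apply HWc.
- apply continuity_pt_filterlim; now apply HWc.
Qed.

Lemma continuous_RInt_bounds_comp {T : UniformSpace} (g : R -> R -> R) (X Y Z : T -> R) (z : T) :
  locally (Z z) (fun t => forall x, cont2 g x t) ->
  continuous X z -> continuous Y z -> continuous Z z ->
  continuous (fun y => RInt (fun x => g x (Z y)) (X y) (Y y)) z.
Proof.
intros Hg HX HY HZ.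
assert (HXY : continuous (fun y => (X y, Y y)) z).
{ apply (continuous_comp_2 X Y (fun a b => (a, b)) z HX HY).
  apply (continuous_ext (fun w : R * R => w)); [| apply continuous_id].
  now intros [a b]. }
apply (continuous_comp_2 (fun y => (X y, Y y)) Z
  (fun ab t => RInt (fun x => g x t) (fst ab) (snd ab)) z HXY HZ).
exact (continuous_RInt_bounds_param g (X z) (Y z) (Z z) Hg).
Qed.

(** The formula involves [u] and [p] but not [uxx], so regularity up to the lateral boundary is
    enough. As [u] and [p] are defined for all real [x], negative [e] is allowed and continuity at
    [e = 0] is two-sided. *)
Lemma flux_rate_continuous {alpha L tau : R} {sg dsg : R -> R} {u p uxx : R -> R -> R}
    (ph : phase alpha L tau sg dsg u p uxx) (phi phi1 phi2 : R -> R) :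
  (forall v, continuous phi v) -> (forall v, continuous phi1 v) ->
  (forall v, continuous phi2 v) -> forall t, 0 < t < tau ->
  cont2 (flux_rate alpha sg dsg u p phi phi1 phi2) 0 t.
Proof.
intros H H1 H2 t Ht.
set (z0 := (0, t)).
assert (Hs : continuous (fun z : R * R => snd z) z0) by apply continuous_snd.
assert (Hf : continuous (fun z : R * R => fst z) z0) by apply continuous_fst.
assert (Hb : continuous (fun z : R * R => sg (snd z) - fst z) z0).
{ apply (continuous_minus (fun z : R * R => sg (snd z)) fst); [| trivial].
  apply (continuous_comp snd sg); trivial.
  now apply (ph_front_continuous ph). }
pose proof (ph_cont _ _ _ _ _ _ _ _ ph) as Hu.
pose proof (ph_cont_dx _ _ _ _ _ _ _ _ ph) as Hp.
assert (K : forall (f : R -> R -> R) (X : R * R -> R), (forall x r, 0 < r < tau -> cont2 f x r) ->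
  continuous X z0 -> continuous (fun z => f (X z) (snd z)) z0).
{ intros f X Hcf HX; apply (cont2_comp f X snd z0); trivial; now apply Hcf. }
assert (Hflux : forall x r, 0 < r < tau -> cont2 (fun x r => phi1 (u x r) * p x r) x r).
{ intros x r Hr; apply (cont2_mult (fun x r => phi1 (u x r)) p); [apply cont2_outer|]; auto. }
assert (Hdis : forall x r, 0 < r < tau -> cont2 (fun x r => phi2 (u x r) * p x r ^ 2) x r).
{ intros x r Hr; apply (cont2_mult (fun x r => phi2 (u x r)) (fun x r => p x r ^ 2));
    [apply cont2_outer; auto|].
  apply (cont2_mult p (fun x r => p x r * 1)); [now auto|].
  apply (cont2_mult p (fun _ _ => 1)); [now auto | apply continuous_const]. }
unfold cont2, flux_rate; fold z0.
apply (continuous_plus (fun z : R * R => alpha * (phi1 (u (sg (snd z) - fst z) (snd z)) * p (sg (snd z) - fst z) (snd z)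
   - phi1 (u (fst z) (snd z)) * p (fst z) (snd z)
   - RInt (fun x => phi2 (u x (snd z)) * p x (snd z) ^ 2) (fst z) (sg (snd z) - fst z)))
   (fun z => phi (u (sg (snd z) - fst z) (snd z)) * dsg (snd z))).
- apply (continuous_mult (fun _ => alpha)); [apply continuous_const|].
  apply (continuous_minus (fun z : R * R => phi1 (u (sg (snd z) - fst z) (snd z)) * p (sg (snd z) - fst z) (snd z)
     - phi1 (u (fst z) (snd z)) * p (fst z) (snd z))
     (fun z => RInt (fun x => phi2 (u x (snd z)) * p x (snd z) ^ 2) (fst z) (sg (snd z) - fst z))).
  + apply (continuous_minus (fun z : R * R => phi1 (u (sg (snd z) - fst z) (snd z)) * p (sg (snd z) - fst z) (snd z))
     (fun z => phi1 (u (fst z) (snd z)) * p (fst z) (snd z))).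
    * now apply (K (fun x r => phi1 (u x r) * p x r)).
    * now apply (K (fun x r => phi1 (u x r) * p x r)).
  + apply (continuous_RInt_bounds_comp (fun x r => phi2 (u x r) * p x r ^ 2)); trivial.
    generalize (locally_open_interval 0 tau t Ht); apply filter_imp; auto.
- apply (continuous_mult (fun z : R * R => phi (u (sg (snd z) - fst z) (snd z)))
   (fun z => dsg (snd z))).
  + apply (continuous_comp (fun z : R * R => u (sg (snd z) - fst z) (snd z)) phi); trivial.
    now apply K.
  + apply (continuous_comp snd dsg); trivial.
    now apply (ph_front_cont _ _ _ _ _ _ _ _ ph).
Qed.

(** Exchange of a derivative and a limit: for fixed small [e] the mean value theorem compares the
    increment of the truncated integral over a step [h] with the rate at an intermediate time, which
    is uniformly close to the limit rate. Then [e] tends to 0 with [h] fixed. *)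
Lemma energy_derive {alpha L tau : R} {sg dsg : R -> R} {u p uxx : R -> R -> R}
    (ph : phase alpha L tau sg dsg u p uxx) (phi phi1 phi2 : R -> R) :
  (forall v, is_derive phi v (phi1 v)) -> (forall v, is_derive phi1 v (phi2 v)) ->
  (forall v, continuous phi2 v) -> phi 0 = 0 ->
  forall t, 0 < t < tau ->
  is_derive (fun r => RInt (fun x => phi (u x r)) 0 (sg r)) t
    (alpha * (phi1 0 * p (sg t) t - phi1 (u 0 t) * p 0 t
      - RInt (fun x => phi2 (u x t) * p x t ^ 2) 0 (sg t))).
Proof.
intros H H1 H2c H0 t Ht.
destruct (C2_continuous phi phi1 phi2 H H1) as [Hc H1c].
set (Rf := flux_rate alpha sg dsg u p phi phi1 phi2).
set (R0 := alpha * _).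
assert (HR0 : Rf 0 t = R0).
{ unfold Rf, flux_rate, R0.
  assert (Hz : u (sg t) t = 0) by (apply (ph_zero _ _ _ _ _ _ _ _ ph); lra).
  rewrite Rminus_0_r, Hz, H0; ring. }
set (G := fun e r => RInt (fun x => phi (u x r)) e (sg r - e)).
assert (HG0 : forall r, RInt (fun x => phi (u x r)) 0 (sg r) = G 0 r).
{ intros r; unfold G; now rewrite Rminus_0_r. }
assert (HGc : forall r, 0 < r < tau -> continuous (fun e => G e r) 0).
{ intros r Hr; unfold G.
  apply (continuous_RInt_bounds_comp (fun x r => phi (u x r)) (fun e => e) (fun e => sg r - e) (fun _ => r)).
  - generalize (locally_open_interval 0 tau r Hr); apply filter_imp; intros q Hq x.
    apply cont2_outer; trivial; now apply (ph_cont _ _ _ _ _ _ _ _ ph).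
  - apply continuous_id.
  - apply (continuous_minus (fun _ => sg r) (fun e => e)); [apply continuous_const | apply continuous_id].
  - apply continuous_const. }
pose proof (flux_rate_continuous ph phi phi1 phi2 Hc H1c H2c t Ht) as HRc.
apply is_derive_Reals; intros eta Heta.
assert (Heta2 : 0 < eta / 2) by lra.
destruct (proj1 (locally_pair_R 0 t _) (proj1 (continuous_eps _ _) HRc (eta / 2) Heta2))
  as [d1 [Hd1 HRd]]; simpl in HRd; fold Rf in HRd; rewrite HR0 in HRd.
pose proof (proj1 (ph_front _ _ _ _ _ _ _ _ ph t ltac:(lra))) as Hst.
assert (Hloc : locally t (fun r => sg t / 2 < sg r)).
{ apply (ph_front_continuous ph t Ht), (open_gt (sg t / 2)); lra. }
destruct (filter_and _ _ Hloc (locally_open_interval 0 tau t Ht)) as [d2 Hd2].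
assert (Hd : 0 < Rmin d1 d2) by (apply Rmin_pos; [trivial | apply cond_pos]).
exists (mkposreal _ Hd); intros h Hh0 Hh; simpl in Hh.
pose proof (Rmin_l d1 d2); pose proof (Rmin_r d1 d2).
assert (Hball : forall r, Rabs (r - t) <= Rabs h -> sg t / 2 < sg r /\ 0 < r < tau).
{ intros r Hr; apply Hd2; change (Rabs (r - t) < d2); lra. }
assert (HI : forall r, Rmin t (t + h) <= r <= Rmax t (t + h) -> Rabs (r - t) <= Rabs h).
{ intros r; unfold Rmin, Rmax; repeat destruct Rle_dec; intros Hr;
  unfold Rabs; repeat destruct Rcase_abs; lra. }
assert (Hth : 0 < t + h < tau).
{ apply (Hball (t + h)); replace (t + h - t) with h by ring; lra. }
assert (Hest : Rabs (G 0 (t + h) - G 0 t - h * R0) <= Rabs h * (eta / 2)).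
(* For [e < sg t / 4] the truncated interval is nonempty throughout the time step, since the front
   stays above [sg t / 2]. The limit gives a weak inequality, hence [eta / 2]. *)
{ apply (Rabs_le_limit (fun e => G e (t + h) - G e t - h * R0) (Rmin d1 (sg t / 4))).
  - apply Rmin_pos; lra.
  - apply (continuous_minus (fun e => G e (t + h) - G e t) (fun _ => h * R0));
      [| apply continuous_const].
    apply (continuous_minus (fun e => G e (t + h)) (fun e => G e t)); now apply HGc.
  - intros e He.
    pose proof (Rmin_l d1 (sg t / 4)); pose proof (Rmin_r d1 (sg t / 4)).
    assert (HGd : forall r, Rmin t (t + h) <= r <= Rmax t (t + h) ->
      is_derive (G e) r (Rf e r)).
    { intros r Hr; destruct (Hball r (HI r Hr)) as [Hr1 Hr2].
      apply (truncated_energy_derive ph phi phi1 phi2); trivial; lra. }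
    destruct (MVT_gen (G e) t (t + h) (Rf e)) as [xi [Hxi E]].
    + intros r Hr; apply HGd; lra.
    + intros r Hr; apply continuity_pt_filterlim.
      apply (ex_derive_continuous (G e)); exists (Rf e r); now apply HGd.
    + rewrite E; replace (t + h - t) with h by ring.
      replace (Rf e xi * h - h * R0) with (h * (Rf e xi - R0)) by ring.
      rewrite Rabs_mult; apply Rmult_le_compat_l; [apply Rabs_pos|].
      left; apply HRd; [rewrite Rminus_0_r, Rabs_pos_eq; lra|].
      pose proof (HI xi Hxi); lra. }
rewrite !HG0.
replace ((G 0 (t + h) - G 0 t) / h - R0) with ((G 0 (t + h) - G 0 t - h * R0) / h) by (field; trivial).
unfold Rdiv; rewrite Rabs_mult, Rabs_inv.
apply Rle_lt_trans with (Rabs h * (eta / 2) * / Rabs h).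
- apply Rmult_le_compat_r; trivial.
  left; now apply Rinv_0_lt_compat, Rabs_pos_lt.
- replace (Rabs h * (eta / 2) * / Rabs h) with (eta / 2); [lra|].
  field; now apply Rabs_no_R0.
Qed.

(** * Initial time and sign of the temperature *)

(** Since [u] vanishes beyond the front, the moving domain can be replaced by the fixed one
    [[0, L]]. This is what makes continuity at time 0 a question about a parameter integral with
    fixed bounds. *)
Lemma energy_whole_interval {alpha L tau : R} {sg dsg : R -> R} {u p uxx : R -> R -> R}
    (ph : phase alpha L tau sg dsg u p uxx) (phi : R -> R) (t : R) :
  phi 0 = 0 -> 0 <= t < tau -> ex_RInt (fun x => phi (u x t)) 0 L ->
  ex_RInt (fun x => phi (u x t)) 0 (sg t) /\
  RInt (fun x => phi (u x t)) 0 L = RInt (fun x => phi (u x t)) 0 (sg t).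
Proof.
intros H0 Ht Hi.
pose proof (ph_front _ _ _ _ _ _ _ _ ph t Ht) as Hs.
assert (H1 : ex_RInt (fun x => phi (u x t)) 0 (sg t)).
{ apply (ex_RInt_Chasles_1 (V := R_CompleteNormedModule) _ 0 (sg t) L); [lra | trivial]. }
assert (H2 : ex_RInt (fun x => phi (u x t)) (sg t) L).
{ apply (ex_RInt_Chasles_2 (V := R_CompleteNormedModule) _ 0 (sg t) L); [lra | trivial]. }
split; trivial.
assert (Hz : RInt (fun x => phi (u x t)) (sg t) L = 0).
{ apply RInt_eq_zero; [lra|].
  intros x Hx; rewrite (ph_zero _ _ _ _ _ _ _ _ ph) by lra; trivial. }
rewrite (RInt_split _ 0 (sg t) L), Hz by trivial; apply Rplus_0_r.
Qed.

Lemma ph_slice_continuous {alpha L tau : R} {sg dsg : R -> R} {u p uxx : R -> R -> R}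
    (ph : phase alpha L tau sg dsg u p uxx) (phi : R -> R) (t : R) :
  (forall v, continuous phi v) -> 0 < t < tau ->
  forall x, continuous (fun y => phi (u y t)) x.
Proof.
intros Hc Ht x; apply (cont2_left (fun y r => phi (u y r))).
apply cont2_outer; trivial; now apply (ph_cont _ _ _ _ _ _ _ _ ph).
Qed.

(** Reading time through [Rabs] expresses right continuity at 0 as ordinary continuity. *)
Lemma energy_initial {alpha L tau : R} {sg dsg : R -> R} {u p uxx : R -> R -> R}
    (ph : phase alpha L tau sg dsg u p uxx) (phi : R -> R) :
  0 < tau -> (forall v, continuous phi v) -> phi 0 = 0 ->
  ex_RInt (fun x => phi (u x 0)) 0 (sg 0) /\
  continuous (fun t => RInt (fun x => phi (u x (Rabs t))) 0 (sg (Rabs t))) 0.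
Proof.
intros Htau Hc H0.
set (g := fun x t => phi (u x (Rabs t))).
pose proof (ph_front _ _ _ _ _ _ _ _ ph 0 ltac:(lra)) as Hs0.
assert (Hsmall : locally 0 (fun t => Rabs t < tau)).
{ exists (mkposreal _ Htau); intros t Ht.
  change (Rabs (t - 0) < tau) in Ht; now rewrite Rminus_0_r in Ht. }
destruct (ph_init _ _ _ _ _ _ _ _ ph) as [D HD].
assert (Hg0 : forall x, g x 0 = phi (u x 0)) by (intros x; unfold g; now rewrite Rabs_R0).
assert (Hgs : forall t, t <> 0 -> Rabs t < tau -> forall x, continuous (fun y => g y t) x).
{ intros t Ht Hr x; apply (ph_slice_continuous ph phi (Rabs t)); trivial.
  split; [now apply Rabs_pos_lt | trivial]. }
destruct (RInt_param_continuous_piecewise g D 0 L) as [I C].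
- lra.
- generalize Hsmall; apply filter_imp; auto.
- intros x Hx; destruct (ph_bounded _ _ _ _ _ _ _ _ ph x Hx) as [B HB].
  (* Near [(x, 0)] the values of [u] stay in [[- B, B]], on which [phi] is bounded. *)
  destruct (continuous_bounded phi (- B) B Hc) as [K [_ HK]].
  exists K; generalize HB; apply filter_imp; intros z Hz; unfold g; apply HK.
  now apply Rabs_le_between.
- intros x Hx HxD; apply (cont2_outer phi (fun y t => u y (Rabs t))); trivial; now apply HD.
- intros x Hx; destruct (ph_left _ _ _ _ _ _ _ _ ph x Hx) as [l Hl]; exists (phi l).
  apply (filterlim_ext (fun y => phi (u y 0))); [intros y; now rewrite Hg0|].
  eapply filterlim_comp; [exact Hl | apply Hc].
- intros x Hx; destruct (ph_right _ _ _ _ _ _ _ _ ph x Hx) as [l Hl]; exists (phi l).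
  apply (filterlim_ext (fun y => phi (u y 0))); [intros y; now rewrite Hg0|].
  eapply filterlim_comp; [exact Hl | apply Hc].
- assert (I0 : ex_RInt (fun x => phi (u x 0)) 0 L).
  { apply (ex_RInt_ext_R (fun x => g x 0)); [lra | intros; apply Hg0 | trivial]. }
  split; [now apply (energy_whole_interval ph)|].
  apply (continuous_ext_loc _ (fun t => RInt (fun x => g x t) 0 L)); [| exact C].
  generalize Hsmall; apply filter_imp; intros t Ht.
  apply (energy_whole_interval ph phi (Rabs t)); trivial.
  + split; [apply Rabs_pos | trivial].
  + destruct (Req_dec t 0) as [->|Hne]; [exact I|].
    apply ex_RInt_cont; now apply Hgs.
Qed.

Lemma energy_ex_RInt {alpha L tau : R} {sg dsg : R -> R} {u p uxx : R -> R -> R}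
    (ph : phase alpha L tau sg dsg u p uxx) (phi : R -> R) (t : R) :
  (forall v, continuous phi v) -> phi 0 = 0 -> 0 <= t < tau ->
  ex_RInt (fun x => phi (u x t)) 0 (sg t).
Proof.
intros Hc H0 Ht; destruct (Req_dec t 0) as [->|Hne].
- apply (energy_initial ph phi); trivial; lra.
- apply ex_RInt_cont; apply (ph_slice_continuous ph phi); trivial; lra.
Qed.

(** If [F t] exceeded [F 0], continuity would give a small [e > 0] with [F e < F t], against the
    mean value theorem on [[e, t]]. No derivative at 0 is involved. *)
Lemma nonincreasing_from_initial (F dF : R -> R) (tau : R) :
  continuous (fun t => F (Rabs t)) 0 ->
  (forall t, 0 < t < tau -> is_derive F t (dF t)) ->
  (forall t, 0 < t < tau -> dF t <= 0) ->
  forall t, 0 <= t < tau -> F t <= F 0.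
Proof.
intros Hc Hd Hneg t Ht.
destruct (Req_dec t 0) as [->|Hne]; [lra|].
apply Rnot_lt_le; intros Hlt.
assert (Hpos : locally 0 (fun e => 0 < F t - F (Rabs e))).
{ apply (continuous_positive (fun e => F t - F (Rabs e))); [| rewrite Rabs_R0; lra].
  apply (continuous_minus (fun _ => F t) (fun e => F (Rabs e))); [apply continuous_const | trivial]. }
destruct Hpos as [d Hdl]; pose proof (cond_pos d).
set (e := Rmin (d / 2) (t / 2)).
assert (0 < e) by (apply Rmin_pos; lra).
assert (e <= d / 2) by apply Rmin_l; assert (e <= t / 2) by apply Rmin_r.
assert (Hb : 0 < F t - F (Rabs e)).
{ apply Hdl; change (Rabs (e - 0) < d); rewrite Rminus_0_r, Rabs_pos_eq; lra. }
rewrite Rabs_pos_eq in Hb by lra.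
destruct (MVT_gen F e t dF) as [x [Hx E]].
- rewrite Rmin_left, Rmax_right by lra; intros x Hx; apply Hd; lra.
- rewrite Rmin_left, Rmax_right by lra; intros x Hx; apply continuity_pt_filterlim.
  apply (ex_derive_continuous F); exists (dF x); apply Hd; lra.
- rewrite Rmin_left, Rmax_right in Hx by lra.
  specialize (Hneg x ltac:(lra)); nra.
Qed.

(** The primitive of [f] from [a] is zero throughout the open interval, hence so is its derivative
    [f]. *)
Lemma RInt_nonneg_zero (f : R -> R) (a b : R) :
  (forall x, continuous f x) -> (forall x, 0 <= f x) -> RInt f a b <= 0 ->
  forall x, a < x < b -> f x = 0.
Proof.
intros Hc Hpos Hle x Hx.
assert (H0 : locally x (fun y => 0 = RInt f a y)).
{ generalize (locally_open_interval a b x Hx); apply filter_imp; intros y Hy.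
  assert (0 <= RInt f a y) by (apply RInt_ge_0; [lra | now apply ex_RInt_cont | auto]).
  assert (0 <= RInt f y b) by (apply RInt_ge_0; [lra | now apply ex_RInt_cont | auto]).
  rewrite (RInt_split f a y b) in Hle by now apply ex_RInt_cont.
  lra. }
pose proof (is_derive_RInt_upper f a x Hc) as H1.
rewrite <- (is_derive_unique _ _ _ H1).
apply is_derive_unique.
apply (is_derive_ext_loc (fun _ => 0) _ x 0 H0), (is_derive_const 0 x).
Qed.

(** Second derivative of the convex test function for the sign. Integrated twice it gives
    [- v ^ 3 / 6] for [v < 0] and 0 otherwise. The square of the negative part would be simpler but
    is not C^2. *)
Definition negative_part (v : R) : R := Rmax 0 (- v).
Definition negative_part_int (v : R) : R := RInt negative_part 0 v.
Definition negative_part_int2 (v : R) : R := RInt negative_part_int 0 v.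

Lemma negative_part_continuous (v : R) : continuous negative_part v.
Proof.
apply (continuous_ext (fun v => (Rabs v - v) / 2)).
- intros x; unfold negative_part, Rmax, Rabs; destruct Rcase_abs, Rle_dec; lra.
- apply (continuous_mult (fun v => Rabs v - v) (fun _ => / 2)); [| apply continuous_const].
  apply (continuous_minus Rabs (fun v => v)); [apply continuous_Rabs | apply continuous_id].
Qed.

Lemma negative_part_int_derive (v : R) : is_derive negative_part_int v (negative_part v).
Proof. apply is_derive_RInt_upper, negative_part_continuous. Qed.

Lemma negative_part_int_continuous (v : R) : continuous negative_part_int v.
Proof.
apply (ex_derive_continuous negative_part_int); eexists; apply negative_part_int_derive.
Qed.

Lemma negative_part_int2_derive (v : R) : is_derive negative_part_int2 v (negative_part_int v).
Proof. apply is_derive_RInt_upper, negative_part_int_continuous. Qed.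

Lemma negative_part_int_zero (v : R) : 0 <= v -> negative_part_int v = 0.
Proof.
intros Hv; unfold negative_part_int.
apply RInt_eq_zero; trivial.
intros x Hx; unfold negative_part; apply Rmax_left; lra.
Qed.

Lemma negative_part_int_neg (v : R) : v < 0 -> negative_part_int v < 0.
Proof.
intros Hv; unfold negative_part_int.
rewrite (RInt_swap_R negative_part v 0) by (apply ex_RInt_cont, negative_part_continuous).
apply Ropp_lt_gt_0_contravar, RInt_gt_0; trivial.
- intros x Hx; unfold negative_part; rewrite Rmax_right; lra.
- intros x _; apply negative_part_continuous.
Qed.

Lemma negative_part_int_nonpos (v : R) : negative_part_int v <= 0.
Proof.
destruct (Rle_or_lt 0 v) as [H|H].
- rewrite negative_part_int_zero; lra.
- left; now apply negative_part_int_neg.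
Qed.

Lemma negative_part_int2_zero (v : R) : 0 <= v -> negative_part_int2 v = 0.
Proof.
intros Hv; unfold negative_part_int2.
apply RInt_eq_zero; trivial.
intros x Hx; apply negative_part_int_zero; lra.
Qed.

Lemma negative_part_int2_pos (v : R) : v < 0 -> 0 < negative_part_int2 v.
Proof.
intros Hv; unfold negative_part_int2.
assert (Hc : forall x, continuous (fun x => -1 * negative_part_int x) x).
{ intros x; apply (continuous_mult (fun _ => -1) negative_part_int);
  [apply continuous_const | apply negative_part_int_continuous]. }
rewrite (RInt_swap_R negative_part_int v 0) by (apply ex_RInt_cont, negative_part_int_continuous).
assert (Hlt : 0 < RInt (fun x => -1 * negative_part_int x) v 0).
{ apply RInt_gt_0; trivial.
  intros x Hx; pose proof (negative_part_int_neg x); lra. }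
rewrite RInt_scal_R in Hlt by (apply ex_RInt_cont, negative_part_int_continuous); lra.
Qed.

Lemma negative_part_int2_nonneg (v : R) : 0 <= negative_part_int2 v.
Proof.
destruct (Rle_or_lt 0 v) as [H|H].
- rewrite negative_part_int2_zero; lra.
- left; now apply negative_part_int2_pos.
Qed.

(* The energy of the negative part of [u] vanishes at the initial time and
   does not increase. *)
Lemma phase_nonneg {alpha L tau : R} {sg dsg : R -> R} {u p uxx : R -> R -> R}
    (ph : phase alpha L tau sg dsg u p uxx) :
  0 <= alpha ->
  (forall x, 0 < x < sg 0 -> 0 <= u x 0) ->
  (forall t, 0 < t < tau -> p 0 t <= 0) ->
  forall x t, 0 < t < tau -> 0 < x < sg t -> 0 <= u x t.
Proof.
intros Ha Hu0 Hp x t Ht Hx.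
pose proof negative_part_int2_derive as Hd.
pose proof negative_part_int_derive as Hd1.
pose proof negative_part_continuous as Hc2.
destruct (C2_continuous _ _ _ Hd Hd1) as [Hc Hc1].
assert (H00 : negative_part_int2 0 = 0) by (apply negative_part_int2_zero; lra).
assert (H10 : negative_part_int 0 = 0) by (apply negative_part_int_zero; lra).
assert (Hle : RInt (fun x => negative_part_int2 (u x t)) 0 (sg t)
  <= RInt (fun x => negative_part_int2 (u x 0)) 0 (sg 0)).
{ apply (nonincreasing_from_initial (fun r => RInt (fun x => negative_part_int2 (u x r)) 0 (sg r))
    (fun t => alpha * (negative_part_int 0 * p (sg t) t - negative_part_int (u 0 t) * p 0 t
      - RInt (fun x => negative_part (u x t) * p x t ^ 2) 0 (sg t))) tau).
  - apply (energy_initial ph negative_part_int2); trivial; lra.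
  - intros r Hr; now apply (energy_derive ph).
  - intros r Hr; rewrite H10.
    assert (0 <= RInt (fun x => negative_part (u x r) * p x r ^ 2) 0 (sg r)).
    { pose proof (ph_front _ _ _ _ _ _ _ _ ph r ltac:(lra)).
      apply RInt_ge_0; [lra | |].
      - apply ex_RInt_cont; intros y.
        apply (continuous_mult (fun y => negative_part (u y r)) (fun y => p y r ^ 2)).
        + now apply (ph_slice_continuous ph negative_part).
        + assert (Hpc : continuous (fun y => p y r) y).
          { apply cont2_left; now apply (ph_cont_dx _ _ _ _ _ _ _ _ ph). }
          apply (continuous_mult (fun y => p y r) (fun y => p y r * 1)); trivial.
          apply (continuous_mult (fun y => p y r) (fun _ => 1)); trivial.
          apply continuous_const.
      - intros y _; apply Rmult_le_pos; [apply Rmax_l | apply pow2_ge_0]. }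
    (* At the fixed end both factors of the boundary term are nonpositive, as heat can only enter
       there. Their product is nonnegative and is subtracted in the rate. *)
    specialize (Hp r Hr); pose proof (negative_part_int_nonpos (u 0 r)).
    assert (0 <= negative_part_int (u 0 r) * p 0 r) by nra.
    nra.
  - lra. }
assert (Hz : RInt (fun x => negative_part_int2 (u x 0)) 0 (sg 0) = 0).
{ apply RInt_eq_zero.
  - pose proof (ph_front _ _ _ _ _ _ _ _ ph 0 ltac:(lra)); lra.
  - intros y Hy; apply negative_part_int2_zero; auto. }
rewrite Hz in Hle.
assert (HE : negative_part_int2 (u x t) = 0).
{ apply (RInt_nonneg_zero (fun y => negative_part_int2 (u y t)) 0 (sg t)); trivial.
  - now apply (ph_slice_continuous ph negative_part_int2).
  - intros y; apply negative_part_int2_nonneg. }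
apply Rnot_lt_le; intros Hneg.
pose proof (negative_part_int2_pos _ Hneg); lra.
Qed.

(** * Decay in one phase *)

Lemma exp_nondecreasing (x y : R) : x <= y -> exp x <= exp y.
Proof.
intros [H| ->]; [left; now apply exp_increasing | lra].
Qed.

Definition heat (sg : R -> R) (u : R -> R -> R) (t : R) : R :=
  RInt (fun x => u x t) 0 (sg t).

Definition energy (sg : R -> R) (u : R -> R -> R) (t : R) : R :=
  RInt (fun x => u x t ^ 2) 0 (sg t).

Lemma is_derive_square (v : R) : is_derive (fun v => v ^ 2) v (2 * v).
Proof. auto_derive; [trivial | ring]. Qed.

Lemma is_derive_double (v : R) : is_derive (fun v => 2 * v) v 2.
Proof. auto_derive; [trivial | ring]. Qed.

Lemma continuous_square (v : R) : continuous (fun v => v ^ 2) v.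
Proof.
apply (ex_derive_continuous (fun v : R => v ^ 2)); eexists; apply is_derive_square.
Qed.

Section OnePhase.

Context {alpha L tau : R} {sg dsg : R -> R} {u p uxx : R -> R -> R}.
Context (ph : phase alpha L tau sg dsg u p uxx).

Lemma heat_derive (t : R) :
  0 < t < tau -> is_derive (heat sg u) t (alpha * (p (sg t) t - p 0 t)).
Proof.
intros Ht.
replace (alpha * (p (sg t) t - p 0 t)) with
  (alpha * (1 * p (sg t) t - 1 * p 0 t - RInt (fun x => 0 * p x t ^ 2) 0 (sg t))).
- apply (energy_derive ph (fun v => v) (fun _ => 1) (fun _ => 0)); trivial.
  + intros v; apply (is_derive_id v).
  + intros v; apply (is_derive_const 1 v).
  + intros v; apply continuous_const.
- rewrite RInt_eq_zero; [ring | | intros; ring].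
  pose proof (ph_front _ _ _ _ _ _ _ _ ph t ltac:(lra)); lra.
Qed.

Lemma ex_RInt_square_dx (t a b : R) :
  0 < t < tau -> ex_RInt (fun x => p x t ^ 2) a b.
Proof.
intros Ht; apply ex_RInt_cont; intros x.
apply (continuous_comp (fun y => p y t) (fun v => v ^ 2)); [| apply continuous_square].
apply cont2_left; now apply (ph_cont_dx _ _ _ _ _ _ _ _ ph).
Qed.

Lemma energy_square_derive (t : R) :
  0 < t < tau ->
  is_derive (energy sg u) t
    (- 2 * alpha * (u 0 t * p 0 t + RInt (fun x => p x t ^ 2) 0 (sg t))).
Proof.
intros Ht.
replace (- 2 * alpha * (u 0 t * p 0 t + RInt (fun x => p x t ^ 2) 0 (sg t))) with
  (alpha * (2 * 0 * p (sg t) t - 2 * u 0 t * p 0 t - RInt (fun x => 2 * p x t ^ 2) 0 (sg t))).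
- apply (energy_derive ph (fun v => v ^ 2) (fun v => 2 * v) (fun _ => 2)); trivial.
  + apply is_derive_square.
  + apply is_derive_double.
  + intros v; apply continuous_const.
  + ring.
- rewrite RInt_scal_R by now apply ex_RInt_square_dx.
  ring.
Qed.

(** As [u] vanishes at the front, [u x t] is minus the integral of [p] from [x] to the front, and
    Cauchy-Schwarz applies. Besides Poincare's inequality, the case [x = 0] controls the boundary
    term of the energy identity. *)
Lemma square_le_dissipation (t x : R) :
  0 < t < tau -> 0 <= x <= sg t -> u x t ^ 2 <= L * RInt (fun x => p x t ^ 2) 0 (sg t).
Proof.
intros Ht Hx.
pose proof (ph_front _ _ _ _ _ _ _ _ ph t ltac:(lra)) as Hs.
assert (Hpc : forall y, continuous (fun y => p y t) y).
{ intros y; apply cont2_left; now apply (ph_cont_dx _ _ _ _ _ _ _ _ ph). }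
assert (E : RInt (fun y => p y t) x (sg t) = u (sg t) t - u x t).
{ apply (fundamental_theorem_interior (fun y => u y t)); trivial; [lra | |].
  - intros y; apply cont2_left; now apply (ph_cont _ _ _ _ _ _ _ _ ph).
  - intros y Hy; apply (ph_dx _ _ _ _ _ _ _ _ ph); lra. }
rewrite (ph_zero _ _ _ _ _ _ _ _ ph (sg t) t) in E by lra.
assert (H1 : RInt (fun y => p y t) x (sg t) ^ 2
  <= (sg t - x) * RInt (fun y => p y t ^ 2) x (sg t)).
{ apply RInt_square; [lra | now apply ex_RInt_cont | now apply ex_RInt_square_dx]. }
rewrite (RInt_split _ 0 x (sg t)) by now apply ex_RInt_square_dx.
assert (0 <= RInt (fun y => p y t ^ 2) 0 x).
{ apply RInt_ge_0; [lra | now apply ex_RInt_square_dx | intros; apply pow2_ge_0]. }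
assert (0 <= RInt (fun y => p y t ^ 2) x (sg t)).
{ apply RInt_ge_0; [lra | now apply ex_RInt_square_dx | intros; apply pow2_ge_0]. }
rewrite E in H1; nra.
Qed.

Lemma ex_RInt_heat (t : R) : 0 <= t < tau -> ex_RInt (fun x => u x t) 0 (sg t).
Proof.
intros Ht; apply (energy_ex_RInt ph (fun v => v)); trivial.
intros v; apply continuous_id.
Qed.

Lemma ex_RInt_energy (t : R) : 0 <= t < tau -> ex_RInt (fun x => u x t ^ 2) 0 (sg t).
Proof.
intros Ht; apply (energy_ex_RInt ph (fun v => v ^ 2)); trivial.
- apply continuous_square.
- ring.
Qed.

Lemma poincare (t : R) :
  0 < t < tau -> energy sg u t <= L ^ 2 * RInt (fun x => p x t ^ 2) 0 (sg t).
Proof.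
intros Ht; unfold energy; set (D := RInt (fun x => p x t ^ 2) 0 (sg t)).
pose proof (ph_front _ _ _ _ _ _ _ _ ph t ltac:(lra)) as Hs.
assert (0 <= D).
{ apply RInt_ge_0; [lra | now apply ex_RInt_square_dx | intros; apply pow2_ge_0]. }
apply Rle_trans with (RInt (fun _ => L * D) 0 (sg t)).
- apply RInt_le; [lra | apply ex_RInt_energy; lra | apply ex_RInt_const |].
  intros x Hx; apply square_le_dissipation; lra.
- rewrite RInt_const; change (scal (sg t - 0) (L * D)) with ((sg t - 0) * (L * D)).
  assert (0 <= L * D) by nra; nra.
Qed.

Lemma energy_nonneg (t : R) : 0 <= t < tau -> 0 <= energy sg u t.
Proof.
intros Ht; apply RInt_ge_0.
- pose proof (ph_front _ _ _ _ _ _ _ _ ph t Ht); lra.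
- now apply ex_RInt_energy.
- intros; apply pow2_ge_0.
Qed.

(** The factor [sg t] is kept and not bounded by [L]: a thin phase of bounded energy holds little
    heat, which is what prevents a phase from disappearing. *)
Lemma heat_square_le (t : R) :
  0 <= t < tau -> heat sg u t ^ 2 <= sg t * energy sg u t.
Proof.
intros Ht; pose proof (ph_front _ _ _ _ _ _ _ _ ph t Ht).
rewrite <- (Rminus_0_r (sg t)).
apply RInt_square; [lra | now apply ex_RInt_heat | now apply ex_RInt_energy].
Qed.

(* Young's inequality absorbs the boundary term [u(0,t) b e^(-ct)] in half of the
   dissipation, the other half giving the decay by Poincare's inequality. *)
Lemma energy_decay (b c d : R) :
  0 < alpha -> 0 < c -> d <= alpha / L ^ 2 -> d <= c ->
  (forall t, 0 < t < tau -> p 0 t = - (b * exp (- c * t))) ->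
  forall t, 0 <= t < tau ->
  energy sg u t * exp (d * t) <= energy sg u 0 + alpha * L * b ^ 2 / c.
Proof.
intros Ha Hc HdL Hdc Hp t Ht.
assert (HL : 0 < L).
{ pose proof (ph_front _ _ _ _ _ _ _ _ ph t Ht); lra. }
(* The flux at the fixed end contributes at most [K * exp (- c * t)] to the rate of the weighted
   energy. Adding [K / c * exp (- c * t)], whose derivative is the opposite, yields a nonincreasing
   quantity; its value [K / c] at time 0 is the constant of the statement. *)
set (K := alpha * L * b ^ 2).
assert (HK : 0 <= K).
{ unfold K; apply Rmult_le_pos; [nra | apply pow2_ge_0]. }
assert (HcK : 0 <= K / c) by (apply Rdiv_le_0_compat; lra).
set (dF := fun t => exp (d * t) * (- 2 * alpha * (u 0 t * p 0 t + RInt (fun x => p x t ^ 2) 0 (sg t))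
    + d * energy sg u t) - K * exp (- c * t)).
assert (Hle : energy sg u t * exp (d * t) + K / c * exp (- c * t)
  <= energy sg u 0 * exp (d * 0) + K / c * exp (- c * 0)).
{ apply (nonincreasing_from_initial (fun t => energy sg u t * exp (d * t) + K / c * exp (- c * t)) dF tau);
    trivial.
  - assert (Hexp : forall k, continuous (fun t => exp (k * Rabs t)) 0).
    { intros k; apply (continuous_comp (fun t => k * Rabs t) exp); [| apply continuous_exp].
      apply (continuous_mult (fun _ => k) Rabs); [apply continuous_const | apply continuous_Rabs]. }
    apply (continuous_plus (fun t => energy sg u (Rabs t) * exp (d * Rabs t))
      (fun t => K / c * exp (- c * Rabs t))).
    + apply (continuous_mult (fun t => energy sg u (Rabs t)) (fun t => exp (d * Rabs t))); trivial.
      apply (energy_initial ph (fun v => v ^ 2)); [lra | apply continuous_square | ring].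
    + apply (continuous_mult (fun _ => K / c) (fun t => exp (- c * Rabs t))); trivial.
      apply continuous_const.
  - intros r Hr.
    pose proof (energy_square_derive r Hr) as HE.
    unfold dF; auto_derive.
    + eexists; exact HE.
    + change (Derive (fun x => energy sg u x) r) with (Derive (energy sg u) r).
      rewrite (is_derive_unique _ _ _ HE); field; lra.
  - intros r Hr; unfold dF.
    set (D := RInt (fun x => p x r ^ 2) 0 (sg r)).
    pose proof (ph_front _ _ _ _ _ _ _ _ ph r ltac:(lra)) as Hs.
    pose proof (poincare r Hr) as HP; fold D in HP.
    pose proof (square_le_dissipation r 0 Hr ltac:(lra)) as HS; fold D in HS.
    pose proof (energy_nonneg r ltac:(lra)) as HE.
    rewrite (Hp r Hr).
    set (q := b * exp (- c * r)).
    assert (HdE : d * energy sg u r <= alpha * D).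
    { apply Rle_trans with (alpha / L ^ 2 * energy sg u r); [now apply Rmult_le_compat_r|].
      apply Rle_trans with (alpha / L ^ 2 * (L ^ 2 * D)).
      - apply Rmult_le_compat_l; trivial.
        apply Rdiv_le_0_compat; [lra | apply pow_lt; lra].
      - right; field; lra. }
    (* Young's inequality with weight [L], followed by [u 0 r ^ 2 <= L * D]. *)
    assert (HY : 2 * (u 0 r * q) <= D + L * q ^ 2).
    { apply Rmult_le_reg_l with L; trivial.
      pose proof (pow2_ge_0 (u 0 r - L * q)); nra. }
    (* The squared input decays at rate [2 * c]; since [d <= c], the weight leaves at least rate
       [c]. *)
    assert (Hq : q ^ 2 * exp (d * r) <= b ^ 2 * exp (- c * r)).
    { unfold q; rewrite Rpow_mult_distr, Rmult_assoc.
      apply Rmult_le_compat_l; [apply pow2_ge_0|].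
      replace (exp (- c * r) ^ 2) with (exp (- c * r) * exp (- c * r)) by ring.
      rewrite <- 2!exp_plus; apply exp_nondecreasing; nra. }
    pose proof (exp_pos (d * r)).
    assert (HI : - 2 * alpha * (u 0 r * - q + D) + d * energy sg u r <= alpha * L * q ^ 2) by nra.
    apply (Rmult_le_compat_l (exp (d * r))) in HI; [| lra].
    apply (Rmult_le_compat_l (alpha * L)) in Hq; [| nra].
    unfold K; lra. }
rewrite Rmult_0_r, Rmult_0_r, exp_0 in Hle.
pose proof (exp_pos (- c * t)).
assert (0 <= K / c * exp (- c * t)) by (apply Rmult_le_pos; lra).
lra.
Qed.

End OnePhase.

(** * From classical solutions to phases *)

Lemma is_derive_on_interior (D : R -> Prop) (f : R -> R) (x l : R) :
  locally x D -> is_derive_on D f x l -> is_derive f x l.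
Proof.
intros [d1 Hd1] H; apply is_derive_Reals; intros eps He.
destruct (H (fun v => Rabs (v - l) < eps)) as [d2 Hd2].
{ exists (mkposreal eps He); intros v Hv; exact Hv. }
assert (Hd : 0 < Rmin d1 d2) by (apply Rmin_pos; apply cond_pos).
exists (mkposreal _ Hd); intros h Hh Hlt; simpl in Hlt.
pose proof (Rmin_l d1 d2); pose proof (Rmin_r d1 d2).
replace ((f (x + h) - f x) / h) with ((f (x + h) - f x) / (x + h - x)) by (f_equal; ring).
assert (Hball : Rabs (x + h - x) < d1 /\ Rabs (x + h - x) < d2).
{ replace (x + h - x) with h by ring; lra. }
apply Hd2.
- exact (proj2 Hball).
- intros E; apply Hh; lra.
- apply Hd1; exact (proj1 Hball).
Qed.

Lemma filterlim_within {T U : Type} {F : (T -> Prop) -> Prop} {FF : Filter F}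
    {G : (U -> Prop) -> Prop} (D : U -> Prop) (f : T -> U) :
  filterlim f F G -> F (fun x => D (f x)) -> filterlim f F (within D G).
Proof.
intros Hf HD P HP.
generalize (filter_and (F := F) _ _ HD (Hf _ HP)); apply (filter_imp (F := F)).
intros x [H1 H2]; now apply H2.
Qed.

Lemma continuous_affine {T : UniformSpace} (f : T -> R) (o e : R) (x : T) :
  continuous f x -> continuous (fun y => o + e * f y) x.
Proof.
intros Hf; apply (continuous_plus (fun _ => o) (fun y => e * f y)); [apply continuous_const|].
now apply (continuous_mult (fun _ => e) f); [apply continuous_const|].
Qed.

Lemma filterlim_affine_side (o e x : R) (D D' : R -> Prop) :
  (forall y, D y -> D' (o + e * y)) ->
  filterlim (fun y => o + e * y) (within D (locally x)) (within D' (locally (o + e * x))).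
Proof.
intros HD; apply filterlim_within.
- intros P HP.
  generalize (continuous_affine (fun y : R => y) o e x (continuous_id x) P HP).
  apply (filter_imp (F := locally x)); intros y Hy _; exact Hy.
- unfold within; apply filter_forall; exact HD.
Qed.

(** Nearest point of the phase. Composing with it extends a function of the phase constantly beyond
    both ends and keeps it continuous there. *)
Definition clamp (sg : R -> R) (x t : R) : R := Rmax 0 (Rmin x (sg t)).

Lemma clamp_range (sg : R -> R) (x t : R) : 0 <= sg t -> 0 <= clamp sg x t <= sg t.
Proof.
intros H; unfold clamp, Rmax, Rmin; repeat destruct Rle_dec; lra.
Qed.

Lemma clamp_inside (sg : R -> R) (x t : R) : 0 <= x <= sg t -> clamp sg x t = x.
Proof.
intros H; unfold clamp, Rmax, Rmin; repeat destruct Rle_dec; lra.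
Qed.

Lemma clamp_outside (sg : R -> R) (x t : R) : 0 <= sg t <= x -> clamp sg x t = sg t.
Proof.
intros H; unfold clamp, Rmax, Rmin; repeat destruct Rle_dec; lra.
Qed.

Lemma continuous_Rmax_Rmin {T : UniformSpace} (f g : T -> R) (x : T) :
  continuous f x -> continuous g x -> continuous (fun y => Rmax 0 (Rmin (f y) (g y))) x.
Proof.
intros Hf Hg.
apply (continuous_ext (fun y => (Rabs ((f y + g y - Rabs (f y - g y)) / 2)
  + (f y + g y - Rabs (f y - g y)) / 2) / 2)).
{ intros y; unfold Rmax, Rmin, Rabs; repeat destruct Rcase_abs; repeat destruct Rle_dec; lra. }
assert (Hm : continuous (fun y => (f y + g y - Rabs (f y - g y)) / 2) x).
{ apply (continuous_mult (fun y => f y + g y - Rabs (f y - g y)) (fun _ => / 2));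
    [| apply continuous_const].
  apply (continuous_minus (fun y => f y + g y) (fun y => Rabs (f y - g y))).
  - now apply (continuous_plus f g).
  - apply (continuous_comp (fun y => f y - g y) Rabs); [| apply continuous_Rabs].
    now apply (continuous_minus f g). }
apply (continuous_mult (fun y => Rabs ((f y + g y - Rabs (f y - g y)) / 2)
  + (f y + g y - Rabs (f y - g y)) / 2) (fun _ => / 2)); [| apply continuous_const].
apply (continuous_plus (fun y => Rabs ((f y + g y - Rabs (f y - g y)) / 2))); trivial.
apply (continuous_comp (fun y => (f y + g y - Rabs (f y - g y)) / 2) Rabs); trivial.
apply continuous_Rabs.
Qed.

Section PhaseOfClassicalHeat.

(* The affine change of variable [x = o + e y] with [e = 1] or [e = -1] puts the
   fixed end of the phase at [y = 0] and makes both phases warmer than the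
   interface. *)
Context {alpha : R} {I : R -> Prop} {a b T0 : R -> R} {T Tx Txx Tt : R -> R -> R}.
Context (Hheat : classical_heat alpha I a b T0 T Tx Txx Tt).
Context {L tau m o e : R} {sg : R -> R}.
Context (He : e * e = 1).
Context (HI : forall t, 0 <= t < tau -> I t /\ 0 < sg t < L).
Context (Hab : forall t y, 0 <= t < tau -> 0 <= y <= sg t -> a t <= o + e * y <= b t).
Context (Hab' : forall t y, 0 <= t < tau -> 0 < y < sg t -> a t < o + e * y < b t).
Context (Hsg : forall t, 0 <= t -> continuous_on_at (fun r => 0 <= r) sg t).

(** Each space derivative brings out a factor [e]. With [e * e = 1], no sign is left in [phase_p]
    and one is left in [phase_uxx]. The latter is used only inside the phase, hence needs no
    clamping. *)
Definition phase_u (x t : R) : R := e * (T (o + e * clamp sg x t) t - m).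
Definition phase_p (x t : R) : R := Tx (o + e * clamp sg x t) t.
Definition phase_uxx (x t : R) : R := e * Txx (o + e * x) t.

Lemma front_Rabs_continuous (t : R) : 0 <= t -> continuous (fun r => sg (Rabs r)) t.
Proof.
intros Ht; unfold continuous; rewrite (Rabs_pos_eq t Ht).
eapply filterlim_comp; [| exact (Hsg t Ht)].
apply filterlim_within.
- pose proof (continuous_Rabs t) as H; unfold continuous in H.
  now rewrite (Rabs_pos_eq t Ht) in H.
- apply filter_forall; intros; apply Rabs_pos.
Qed.

Lemma locally_Rabs_lt (t : R) : Rabs t < tau -> locally t (fun r => Rabs r < tau).
Proof. intros Ht; exact (continuous_Rabs t _ (open_lt tau _ Ht)). Qed.

(** Clamping space and reflecting time send a full neighbourhood of [(x, t)] into the region of the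
    phase, so continuity relative to the region becomes ordinary continuity. *)
Lemma clamp_limit (x t : R) : 0 <= t < tau ->
  filterlim (fun z : R * R => (o + e * clamp sg (fst z) (Rabs (snd z)), Rabs (snd z)))
    (locally (x, t))
    (within (region I a b) (locally (o + e * clamp sg x t, t))).
Proof.
intros Ht; apply filterlim_within.
- assert (Hc : continuous (fun z : R * R =>
     (o + e * clamp sg (fst z) (Rabs (snd z)), Rabs (snd z))) (x, t)).
  { apply (continuous_comp_2 (fun z : R * R => o + e * clamp sg (fst z) (Rabs (snd z)))
      (fun z => Rabs (snd z)) pair).
    - apply continuous_affine; unfold clamp.
      apply (continuous_Rmax_Rmin fst (fun z : R * R => sg (Rabs (snd z))));
        [apply continuous_fst|].
      apply (continuous_comp snd (fun r => sg (Rabs r))); [apply continuous_snd|].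
      now apply front_Rabs_continuous.
    - apply (continuous_comp snd Rabs); [apply continuous_snd | apply continuous_Rabs].
    - apply (continuous_ext (fun w : R * R => w)); [now intros [y r] | apply continuous_id]. }
  unfold continuous in Hc; simpl in Hc; now rewrite (Rabs_pos_eq t) in Hc by lra.
- generalize (locally_snd_R x t _ (locally_Rabs_lt t ltac:(rewrite Rabs_pos_eq; lra))).
  apply filter_imp; intros z Hz.
  pose proof (Rabs_pos (snd z)).
  destruct (HI (Rabs (snd z)) ltac:(lra)) as [H1 H2].
  split; [trivial | split; [trivial|]].
  apply Hab; [now split | apply clamp_range; left; exact (proj1 H2)].
Qed.

Lemma phase_u_Rabs_cont2 (x t : R) : 0 <= t < tau ->
  continuous_on_at (region I a b) (fun p : R * R => T (fst p) (snd p)) (o + e * clamp sg x t, t) ->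
  cont2 (fun y r => phase_u y (Rabs r)) x t.
Proof.
intros Ht HT; unfold phase_u.
apply (continuous_mult (fun _ => e)); [apply continuous_const|].
apply (continuous_minus (fun z : R * R => T (o + e * clamp sg (fst z) (Rabs (snd z))) (Rabs (snd z)))
  (fun _ => m)); [| apply continuous_const].
unfold continuous; simpl; rewrite (Rabs_pos_eq t) by lra.
exact (filterlim_comp _ _ _ _ (fun p : R * R => T (fst p) (snd p)) _ _ _ (clamp_limit x t Ht) HT).
Qed.

Lemma cont2_Rabs (f : R -> R -> R) (x t : R) :
  0 < t -> cont2 (fun y r => f y (Rabs r)) x t -> cont2 f x t.
Proof.
intros Ht; apply continuous_ext_loc.
generalize (locally_snd_R x t _ (open_gt 0 t Ht)); apply filter_imp; intros z Hz.
now rewrite Rabs_pos_eq by (left; exact Hz).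
Qed.

Lemma phase_u_cont2 (x t : R) : 0 < t < tau -> cont2 phase_u x t.
Proof.
intros Ht; apply cont2_Rabs; [lra|].
destruct (HI t ltac:(lra)) as [H1 H2].
apply phase_u_Rabs_cont2; [lra|].
apply (heat_cont _ _ _ _ _ _ _ _ _ Hheat); [lra | trivial |].
apply Hab; [lra | apply clamp_range; lra].
Qed.

Lemma phase_p_cont2 (x t : R) : 0 < t < tau -> cont2 phase_p x t.
Proof.
intros Ht; apply cont2_Rabs; [lra|].
destruct (HI t ltac:(lra)) as [H1 H2].
unfold cont2, phase_p, continuous; simpl; rewrite (Rabs_pos_eq t) by lra.
assert (HT := heat_cont_dx _ _ _ _ _ _ _ _ _ Hheat (o + e * clamp sg x t) t ltac:(lra) H1
  (Hab t _ ltac:(lra) (clamp_range sg x t ltac:(lra)))).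
refine (filterlim_comp _ _ _ (fun z : R * R => (o + e * clamp sg (fst z) (Rabs (snd z)), Rabs (snd z)))
  (fun p : R * R => Tx (fst p) (snd p)) _ _ _ _ HT).
assert (Hlim := clamp_limit x t ltac:(lra)).
intros P HP; unfold filtermap.
(* The gradient is continuous only relative to positive times, so positivity of the time coordinate
   is carried as a side condition and discharged near [t > 0]. *)
assert (HP' : within (region I a b) (locally (o + e * clamp sg x t, t)) (fun q => 0 < snd q -> P q)).
{ revert HP; unfold within; apply filter_imp; intros q Hq Hq1 Hq2; apply Hq; now split. }
generalize (filter_and (F := locally (x, t)) _ _ (Hlim _ HP')
  (locally_snd_R x t (fun r => 0 < r) (open_gt 0 t (proj1 Ht)))).
apply (filter_imp (F := locally (x, t))); intros z [Hz1 Hz2]; apply Hz1; simpl.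
apply Rabs_pos_lt, Rgt_not_eq; exact Hz2.
Qed.

Context {dsg : R -> R}.
Context (Hdsg : forall t, 0 < t < tau -> is_derive sg t (dsg t)).
Context (Hdsg_cont : forall t, 0 < t < tau -> continuous dsg t).
Context (Hfront : forall t, 0 <= t < tau -> T (o + e * sg t) t = m).
Context (Hpiece : piecewise_continuous T0 (a 0) (b 0)).
Context (Htau : 0 < tau).

Lemma phase_u_outside (x t : R) : 0 <= t < tau -> sg t <= x -> phase_u x t = 0.
Proof.
intros Ht Hx; destruct (HI t Ht) as [_ Hs].
unfold phase_u; rewrite clamp_outside, Hfront by lra; ring.
Qed.

Lemma locally_inside (x t : R) : 0 < x < sg t -> locally x (fun y => y = clamp sg y t).
Proof.
intros Hx; generalize (locally_open_interval 0 (sg t) x Hx); apply filter_imp.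
intros y Hy; rewrite clamp_inside; lra.
Qed.

Lemma is_derive_affine_arg (f : R -> R) (x l : R) :
  is_derive f (o + e * x) l -> is_derive (fun y => f (o + e * y)) x (e * l).
Proof.
intros Hf; apply (is_derive_comp f (fun y => o + e * y)); trivial.
auto_derive; [trivial | ring].
Qed.

Lemma phase_u_dx (x t : R) : 0 < t < tau -> 0 < x < sg t ->
  is_derive (fun y => phase_u y t) x (phase_p x t).
Proof.
intros Ht Hx; destruct (HI t ltac:(lra)) as [H1 H2].
apply (is_derive_ext_loc (fun y => e * (T (o + e * y) t - m))).
{ generalize (locally_inside x t Hx); apply filter_imp; intros y Hy.
  unfold phase_u; now rewrite <- Hy. }
unfold phase_p; rewrite clamp_inside by lra.
replace (Tx (o + e * x) t) with (e * (e * Tx (o + e * x) t - 0)) by (rewrite Rminus_0_r, <- Rmult_assoc, He; ring).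
apply (is_derive_scal (fun y => T (o + e * y) t - m)).
apply (is_derive_minus (fun y => T (o + e * y) t) (fun _ => m)); [| apply (is_derive_const m x)].
apply (is_derive_affine_arg (fun y => T y t)).
apply (is_derive_on_interior (fun y => a t <= y <= b t)).
- generalize (locally_open_interval _ _ _ (Hab' t x ltac:(lra) Hx)); apply filter_imp.
  intros y Hy; lra.
- apply (heat_dx _ _ _ _ _ _ _ _ _ Hheat); [lra | trivial | apply Hab; lra].
Qed.

Lemma phase_p_dx (x t : R) : 0 < t < tau -> 0 < x < sg t ->
  is_derive (fun y => phase_p y t) x (phase_uxx x t).
Proof.
intros Ht Hx; destruct (HI t ltac:(lra)) as [H1 H2].
apply (is_derive_ext_loc (fun y => Tx (o + e * y) t)).
{ generalize (locally_inside x t Hx); apply filter_imp; intros y Hy.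
  unfold phase_p; now rewrite <- Hy. }
apply (is_derive_affine_arg (fun y => Tx y t)).
apply (heat_dxx _ _ _ _ _ _ _ _ _ Hheat); [lra | trivial | apply Hab'; lra].
Qed.

Lemma front_continuous (t : R) : 0 < t < tau -> continuous sg t.
Proof.
intros Ht; apply (ex_derive_continuous sg); exists (dsg t); auto.
Qed.

Lemma phase_u_dt (x t : R) : 0 < t < tau -> 0 < x < sg t ->
  is_derive (fun r => phase_u x r) t (alpha * phase_uxx x t).
Proof.
intros Ht Hx; destruct (HI t ltac:(lra)) as [H1 H2].
apply (is_derive_ext_loc (fun r => e * (T (o + e * x) r - m))).
{ assert (Hl : locally t (fun r => x < sg r)).
  { apply (front_continuous t Ht), (open_gt x); lra. }
  generalize Hl; apply filter_imp; intros r Hr.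
  unfold phase_u; rewrite clamp_inside; [trivial | lra]. }
replace (alpha * phase_uxx x t) with (e * (Tt (o + e * x) t - 0)).
- apply (is_derive_scal (fun r => T (o + e * x) r - m)).
  apply (is_derive_minus (fun r => T (o + e * x) r) (fun _ => m)); [| apply (is_derive_const m t)].
  apply (heat_dt _ _ _ _ _ _ _ _ _ Hheat); [lra | trivial | apply Hab'; lra].
- unfold phase_uxx; rewrite (heat_eq _ _ _ _ _ _ _ _ _ Hheat); [ring | lra | trivial |].
  apply Hab'; lra.
Qed.

Lemma phase_uxx_cont2 (x t : R) : 0 < t < tau -> 0 < x < sg t -> cont2 phase_uxx x t.
Proof.
intros Ht Hx; destruct (HI t ltac:(lra)) as [H1 H2].
apply (continuous_mult (fun _ => e)); [apply continuous_const|].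
apply (cont2_comp Txx (fun z : R * R => o + e * fst z) snd (x, t)).
- apply (heat_cont_dxx _ _ _ _ _ _ _ _ _ Hheat); [simpl; lra | trivial | apply Hab'; simpl; lra].
- apply continuous_affine, continuous_fst.
- apply continuous_snd.
Qed.

Lemma phase_u_bounded (x : R) : exists B,
  locally (x, 0) (fun z : R * R => Rabs (phase_u (fst z) (Rabs (snd z))) <= B).
Proof.
destruct (HI 0 ltac:(lra)) as [H1 H2].
destruct (heat_init_bounded _ _ _ _ _ _ _ _ _ Hheat (o + e * clamp sg x 0)) as [B HB].
{ apply Hab; [lra | apply clamp_range; lra]. }
exists (Rabs e * (B + Rabs m)).
generalize (clamp_limit x 0 ltac:(lra) _ HB); apply (filter_imp (F := locally (x, 0))).
intros z Hz; simpl in Hz.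
unfold phase_u; rewrite Rabs_mult; apply Rmult_le_compat_l; [apply Rabs_pos|].
unfold Rminus; eapply Rle_trans; [apply Rabs_triang|]; rewrite Rabs_Ropp; lra.
Qed.

Lemma phase_u_init (x : R) : 0 <= x <= sg 0 -> phase_u x 0 = e * (T0 (o + e * x) - m).
Proof.
intros Hx; unfold phase_u; rewrite clamp_inside by trivial.
rewrite (heat_init _ _ _ _ _ _ _ _ _ Hheat); trivial.
apply Hab; lra.
Qed.

(** [D] and [D'] stand for half-lines: they lie on the same side of their points when [e = 1] and on
    opposite sides when [e = -1]. *)
Lemma phase_u_one_sided (x l : R) (D D' : R -> Prop) :
  (forall y, D y -> D' (o + e * y)) ->
  filterlim T0 (within D' (locally (o + e * x))) (locally l) ->
  within D (locally x) (fun y => 0 <= y <= sg 0) ->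
  filterlim (fun y => phase_u y 0) (within D (locally x)) (locally (e * (l - m))).
Proof.
intros HD Hl Hin.
apply (filterlim_ext_loc (fun y => e * (T0 (o + e * y) - m))).
{ revert Hin; unfold within; apply filter_imp; intros y Hy HDy; symmetry; apply phase_u_init; auto. }
apply (filterlim_comp _ _ _ (fun y => T0 (o + e * y)) (fun v => e * (v - m)) _ (locally l)).
- apply (filterlim_comp _ _ _ (fun y => o + e * y) T0 _ (within D' (locally (o + e * x)))); trivial.
  now apply filterlim_affine_side.
- apply (continuous_mult (fun _ => e) (fun v => v - m)); [apply continuous_const|].
  apply (continuous_minus (fun v => v) (fun _ => m)); [apply continuous_id | apply continuous_const].
Qed.

Lemma phase_u_zero_side (x : R) (D : R -> Prop) :
  within D (locally x) (fun y => sg 0 <= y) ->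
  filterlim (fun y => phase_u y 0) (within D (locally x)) (locally 0).
Proof.
intros Hin; apply (filterlim_ext_loc (fun _ => 0)); [| apply filterlim_const].
revert Hin; unfold within; apply filter_imp; intros y Hy HDy; symmetry; apply phase_u_outside; [lra | auto].
Qed.

Lemma reflection_cases : e = 1 \/ e = -1.
Proof.
assert ((e - 1) * (e + 1) = 0) by lra.
destruct (Rmult_integral _ _ H); [left | right]; lra.
Qed.

Lemma phase_u_left (x : R) : 0 < x <= L ->
  exists l, filterlim (fun y => phase_u y 0) (at_left x) (locally l).
Proof.
intros Hx; destruct (HI 0 ltac:(lra)) as [H1 H2].
destruct Hpiece as [D HD].
destruct (Rle_or_lt x (sg 0)) as [Hle|Hlt].
- pose proof (Hab 0 x ltac:(lra) ltac:(lra)) as Hx'.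
  destruct (HD _ Hx') as [_ [Hleft Hright]].
  assert (Hin : at_left x (fun y => 0 <= y <= sg 0)).
  { unfold at_left, within; generalize (open_gt 0 x (proj1 Hx)).
    apply filter_imp; intros y Hy Hy'; lra. }
  pose proof (Hab 0 0 ltac:(lra) ltac:(lra)).
  (* A reflection exchanges the two sides, so a left limit of the phase is then a right limit of
     [T0]. *)
  destruct reflection_cases as [E|E].
  + destruct Hleft as [l Hl]; [rewrite E in *; lra|].
    exists (e * (l - m)); apply (phase_u_one_sided x l _ (fun y => y < o + e * x)); trivial.
    intros y Hy; rewrite E; lra.
  + destruct Hright as [l Hl]; [rewrite E in *; lra|].
    exists (e * (l - m)); apply (phase_u_one_sided x l _ (fun y => y > o + e * x)); trivial.
    intros y Hy; rewrite E; lra.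
- exists 0; apply phase_u_zero_side.
  unfold within; generalize (open_gt (sg 0) x Hlt); apply filter_imp; intros y Hy _; lra.
Qed.

Lemma phase_u_right (x : R) : 0 <= x < L ->
  exists l, filterlim (fun y => phase_u y 0) (at_right x) (locally l).
Proof.
intros Hx; destruct (HI 0 ltac:(lra)) as [H1 H2].
destruct Hpiece as [D HD].
destruct (Rlt_or_le x (sg 0)) as [Hlt|Hle].
- pose proof (Hab 0 x ltac:(lra) ltac:(lra)) as Hx'.
  destruct (HD _ Hx') as [_ [Hleft Hright]].
  assert (Hin : at_right x (fun y => 0 <= y <= sg 0)).
  { unfold at_right, within; generalize (open_lt (sg 0) x Hlt).
    apply filter_imp; intros y Hy Hy'; lra. }
  pose proof (Hab 0 (sg 0) ltac:(lra) ltac:(lra)).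
  destruct reflection_cases as [E|E].
  + destruct Hright as [l Hl]; [rewrite E in *; lra|].
    exists (e * (l - m)); apply (phase_u_one_sided x l _ (fun y => y > o + e * x)); trivial.
    intros y Hy; rewrite E; lra.
  + destruct Hleft as [l Hl]; [rewrite E in *; lra|].
    exists (e * (l - m)); apply (phase_u_one_sided x l _ (fun y => y < o + e * x)); trivial.
    intros y Hy; rewrite E; lra.
- exists 0; apply phase_u_zero_side.
  unfold within; apply filter_forall; intros y Hy; lra.
Qed.

Lemma phase_u_init_continuous : exists D : list R, forall x, 0 < x < L -> ~ In x D ->
  cont2 (fun y t => phase_u y (Rabs t)) x 0.
Proof.
destruct (HI 0 ltac:(lra)) as [H1 H2].
destruct Hpiece as [D HD].
(* The exceptional points of [T0] are carried by the inverse change of variable, which is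
   [e * (y - o)] because [e * e = 1]. The initial front is added, where the inside and outside
   descriptions meet. *)
exists (sg 0 :: map (fun y => e * (y - o)) D); intros x Hx HxD.
destruct (Rtotal_order x (sg 0)) as [Hlt|[->|Hgt]].
- apply phase_u_Rabs_cont2; [lra|].
  rewrite clamp_inside by lra.
  pose proof (Hab 0 x ltac:(lra) ltac:(lra)) as Hx'.
  apply (heat_init_cont _ _ _ _ _ _ _ _ _ Hheat); trivial.
  apply (HD _ Hx'); intros HIn; apply HxD; right.
  replace x with (e * (o + e * x - o)) at 1.
  + now apply (in_map (fun y => e * (y - o))).
  + replace (e * (o + e * x - o)) with (e * e * x) by ring; rewrite He; ring.
- exfalso; apply HxD; now left.
- apply (continuous_ext_loc _ (fun _ => 0)); [| apply continuous_const].
  assert (Hl : locally (x, 0) (fun z : R * R => 0 < fst z - sg (Rabs (snd z)))).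
  { apply (continuous_positive (fun z : R * R => fst z - sg (Rabs (snd z)))).
    - apply (continuous_minus fst (fun z : R * R => sg (Rabs (snd z)))); [apply continuous_fst|].
      apply (continuous_comp snd (fun r => sg (Rabs r))); [apply continuous_snd|].
      apply front_Rabs_continuous; simpl; lra.
    - simpl; rewrite Rabs_R0; lra. }
  assert (Ht : locally (x, 0) (fun z : R * R => Rabs (snd z) < tau)).
  { apply (locally_snd_R x 0 (fun r => Rabs r < tau)), locally_Rabs_lt.
    now rewrite Rabs_R0. }
  generalize (filter_and _ _ Hl Ht); apply filter_imp; intros z [Hz1 Hz2].
  symmetry; apply phase_u_outside; [| lra].
  split; [apply Rabs_pos | trivial].
Qed.

Lemma phase_of_classical_heat : phase alpha L tau sg dsg phase_u phase_p phase_uxx.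
Proof.
constructor; trivial.
- intros t Ht; now apply HI.
- intros x t; apply phase_u_cont2.
- intros x t; apply phase_p_cont2.
- apply phase_u_outside.
- apply phase_u_dx.
- apply phase_p_dx.
- apply phase_u_dt.
- apply phase_uxx_cont2.
- intros x _; apply phase_u_bounded.
- apply phase_u_init_continuous.
- apply phase_u_left.
- apply phase_u_right.
Qed.

End PhaseOfClassicalHeat.

(** * Closed loop *)

(** Integrability is assumed of the reflected integrand, the one that a phase provides, and is
    transported back to [f] by a second substitution. *)
Lemma RInt_reflect (f : R -> R) (a b : R) :
  a <= b -> ex_RInt (fun y => f (b - y)) 0 (b - a) ->
  RInt f a b = RInt (fun y => f (b - y)) 0 (b - a).
Proof.
intros Hab Hi.
set (g := fun y => f (b - y)) in *.
pose proof (RInt_comp_lin g (-1) b a b) as E.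
replace (-1 * a + b) with (b - a) in E by ring.
replace (-1 * b + b) with 0 in E by ring.
specialize (E (ex_RInt_swap _ _ _ Hi)).
rewrite (RInt_swap_R g 0 (b - a) Hi) in E.
assert (Hif : ex_RInt f a b).
{ apply (ex_RInt_ext_R (fun y => -1 * (-1 * g (-1 * y + b)))); trivial.
  - intros x Hx; unfold g; replace (b - (-1 * x + b)) with x by ring; ring.
  - apply ex_RInt_scal_R; apply (ex_RInt_comp_lin g (-1) b a b).
    replace (-1 * a + b) with (b - a) by ring; replace (-1 * b + b) with 0 by ring.
    now apply ex_RInt_swap. }
assert (E2 : RInt (fun y => -1 * f y) a b = - RInt g 0 (b - a)).
{ rewrite <- E; apply RInt_ext_R; trivial.
  intros x Hx; unfold g, scal; simpl; unfold mult; simpl.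
  now replace (b - (-1 * x + b)) with x by ring. }
rewrite RInt_scal_R in E2 by trivial; lra.
Qed.

(** Here [r] is the width of a phase and [h] its heat. If [r < A / 2], the heat balance forces
    [k * h >= g * A / 2], whereas [h ^ 2 <= r * K] makes [h] small with [r]. Writing [K + 1] in [D]
    keeps the denominator positive when [K = 0]. *)
Lemma front_away (g k A K : R) : 0 < g -> 0 < k -> 0 < A -> 0 <= K ->
  exists delta, 0 < delta /\ forall r h, 0 <= r ->
    g * (A - r) <= k * h -> h ^ 2 <= r * K -> delta <= r.
Proof.
intros Hg Hk HA HK.
set (D := k ^ 2 * (K + 1)).
assert (HD : 0 < D) by (unfold D; nra).
exists (Rmin (A / 2) ((g * (A / 2)) ^ 2 / D)); split.
- apply Rmin_pos; [lra|]; apply Rdiv_lt_0_compat; trivial; apply pow_lt; nra.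
- intros r h Hr H1 H2.
  destruct (Rle_or_lt (A / 2) r) as [H|H].
  + eapply Rle_trans; [apply Rmin_l | trivial].
  + eapply Rle_trans; [apply Rmin_r|].
    apply Rle_div_l; trivial.
    assert (g * (A / 2) <= k * h) by nra.
    assert ((g * (A / 2)) ^ 2 <= (k * h) ^ 2) by (apply pow_incr; nra).
    unfold D; rewrite Rpow_mult_distr in *; nra.
Qed.

Section ClosedLoop.

Context {P : material} {c : R} {Tl0 Ts0 : R -> R} {s0 sr : R}.
Context {Tl Ts : R -> R -> R} {s : R -> R}.

Definition liquid : R -> R -> R := @phase_u Tl (T_m P) 0 1 s.
Definition solid_width (t : R) : R := len P - s t.
Definition solid : R -> R -> R := @phase_u Ts (T_m P) (len P) (-1) solid_width.

(** Heat content of the material relative to the equilibrium at the setpoint. The solid enters with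
    a minus sign because [solid] is counted positive below melting. *)
Definition setpoint_gap (t : R) : R :=
  k_l P / alpha_l P * heat s liquid t - k_s P / alpha_s P * heat solid_width solid t
  + gamma P * (s t - sr).

Lemma liquid_inside (x t : R) : 0 <= x <= s t -> liquid x t = Tl x t - T_m P.
Proof.
intros Hx; unfold liquid, phase_u; rewrite clamp_inside by trivial.
replace (0 + 1 * x) with x by ring; ring.
Qed.

Lemma solid_inside (x t : R) : 0 <= x <= solid_width t ->
  solid x t = - (Ts (len P - x) t - T_m P).
Proof.
intros Hx; unfold solid, phase_u; rewrite clamp_inside by trivial.
replace (len P + -1 * x) with (len P - x) by ring; ring.
Qed.

Context (Hc : 0 < c).
Context (Hadm : admissible_data P Tl0 Ts0 s0).
Context (Hinf : 0 < s_infty P Tl0 Ts0 s0 < len P).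
Context (Hsr : s_infty P Tl0 Ts0 s0 < sr < len P).
Context (Hs0 : s 0 = s0).
Context (Hs : forall t, 0 <= t -> continuous_on_at (fun r => 0 <= r) s t).
Context {Tlx Tlxx Tlt Tsx Tsxx Tst : R -> R -> R}.
Context (Hl : classical_heat (alpha_l P) (two_phases P s) (fun _ => 0) s Tl0 Tl Tlx Tlxx Tlt).
Context (Hsol : classical_heat (alpha_s P) (two_phases P s) s (fun _ => len P) Ts0 Ts Tsx Tsxx Tst).
Context (Hbc : forall t, 0 < t -> two_phases P s t ->
      Tlx 0 t = - (feedback P c sr Tl Ts s t / k_l P) /\
      Tsx (len P) t = 0 /\
      Tl (s t) t = T_m P /\
      Ts (s t) t = T_m P /\
      ex_derive s t /\
      gamma P * Derive s t = - k_l P * Tlx (s t) t + k_s P * Tsx (s t) t).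

Lemma solid_width_continuous (t : R) :
  0 <= t -> continuous_on_at (fun r => 0 <= r) solid_width t.
Proof.
intros Ht; specialize (Hs t Ht); unfold continuous_on_at, solid_width in *.
apply (filterlim_comp _ _ _ s (fun v => len P - v) _ _ _ Hs).
apply (continuous_minus (fun _ => len P) (fun v => v)); [apply continuous_const | apply continuous_id].
Qed.

(** At [s0] the lower and upper bounds of (A1) coincide. The interface conditions are imposed only
    for [t > 0], while a phase must vanish at its front at time 0 too. *)
Lemma initial_melting : Tl0 s0 = T_m P /\ Ts0 s0 = T_m P.
Proof.
destruct Hadm as (H0 & _ & _ & Hl' & Hs' & Hl0 & Hs0' & B1 & B2).
specialize (B1 s0 ltac:(lra)); specialize (B2 s0 ltac:(lra)).
rewrite Rminus_diag, Rmult_0_r, Rplus_0_r in *; lra.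
Qed.

(** * Estimates on a time interval where both phases are present *)

Section UpTo.

Context {tau : R} (Htau : 0 < tau).
Context (Htwo : forall t, 0 <= t < tau -> two_phases P s t).

Definition liquid_dx : R -> R -> R := @phase_p Tlx 0 1 s.
Definition solid_dx : R -> R -> R := @phase_p Tsx (len P) (-1) solid_width.

Lemma liquid_range (t : R) : 0 <= t < tau -> two_phases P s t /\ 0 < s t < len P.
Proof. intros Ht; split; now apply Htwo. Qed.

Lemma solid_range (t : R) : 0 <= t < tau -> two_phases P s t /\ 0 < solid_width t < len P.
Proof.
intros Ht; pose proof (Htwo t Ht) as H; split; trivial.
unfold two_phases in H; unfold solid_width; lra.
Qed.

Lemma liquid_dx_cont2 (x t : R) : 0 < t < tau -> cont2 liquid_dx x t.
Proof.
apply (phase_p_cont2 Hl (L := len P)).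
- exact liquid_range.
- intros r y _ Hy; lra.
- exact Hs.
Qed.

Lemma solid_dx_cont2 (x t : R) : 0 < t < tau -> cont2 solid_dx x t.
Proof.
apply (phase_p_cont2 Hsol (L := len P)).
- exact solid_range.
- unfold solid_width; intros r y _ Hy; lra.
- exact solid_width_continuous.
Qed.

Lemma liquid_dx_inside (x t : R) : 0 <= x <= s t -> liquid_dx x t = Tlx x t.
Proof.
intros Hx; unfold liquid_dx, phase_p; rewrite clamp_inside by trivial.
f_equal; ring.
Qed.

Lemma solid_dx_inside (x t : R) : 0 <= x <= solid_width t ->
  solid_dx x t = Tsx (len P - x) t.
Proof.
intros Hx; unfold solid_dx, phase_p; rewrite clamp_inside by trivial.
f_equal; ring.
Qed.

(** The interface condition solved for the speed. In this form its continuity in time follows from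
    that of the gradients up to the front. *)
Definition front_speed (t : R) : R :=
  (- k_l P * liquid_dx (s t) t + k_s P * solid_dx (solid_width t) t) / gamma P.

Lemma front_derive (t : R) : 0 < t < tau -> is_derive s t (front_speed t).
Proof.
intros Ht; pose proof (Htwo t ltac:(lra)) as H2.
destruct (Hbc t ltac:(lra) H2) as (_ & _ & _ & _ & Hd & E).
destruct H2.
replace (front_speed t) with (Derive s t); [now apply Derive_correct|].
pose proof (gamma_pos P).
unfold front_speed; rewrite liquid_dx_inside by lra.
rewrite solid_dx_inside by (unfold solid_width; lra).
replace (len P - solid_width t) with (s t) by (unfold solid_width; ring).
rewrite <- E; field; lra.
Qed.

Lemma front_speed_continuous (t : R) : 0 < t < tau -> continuous front_speed t.
Proof.
intros Ht.
assert (Hsc : continuous s t).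
{ apply (ex_derive_continuous s); eexists; now apply front_derive. }
apply (continuous_mult (fun t => - k_l P * liquid_dx (s t) t + k_s P * solid_dx (solid_width t) t)
  (fun _ => / gamma P)); [| apply continuous_const].
apply (continuous_plus (fun t => - k_l P * liquid_dx (s t) t) (fun t => k_s P * solid_dx (solid_width t) t)).
- apply (continuous_mult (fun _ => - k_l P) (fun t => liquid_dx (s t) t)); [apply continuous_const|].
  apply (cont2_comp liquid_dx s (fun t => t)); trivial; [now apply liquid_dx_cont2 | apply continuous_id].
- apply (continuous_mult (fun _ => k_s P) (fun t => solid_dx (solid_width t) t)); [apply continuous_const|].
  apply (cont2_comp solid_dx solid_width (fun t => t)); trivial;
    [now apply solid_dx_cont2 | | apply continuous_id].
  apply (continuous_minus (fun _ => len P) s); trivial; apply continuous_const.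
Qed.

Lemma melting_at_front (t : R) : 0 <= t < tau -> Tl (s t) t = T_m P /\ Ts (s t) t = T_m P.
Proof.
intros Ht; pose proof (Htwo t Ht) as H2.
destruct (Req_dec t 0) as [->|Hne].
- destruct initial_melting as [E1 E2]; destruct H2.
  rewrite (heat_init _ _ _ _ _ _ _ _ _ Hl) by lra.
  rewrite (heat_init _ _ _ _ _ _ _ _ _ Hsol) by lra.
  now rewrite Hs0.
- destruct (Hbc t ltac:(lra) H2) as (_ & _ & E1 & E2 & _); now split.
Qed.

Lemma liquid_phase : phase (alpha_l P) (len P) tau s front_speed liquid liquid_dx (@phase_uxx Tlxx 0 1).
Proof.
apply (phase_of_classical_heat Hl); trivial.
- ring.
- exact liquid_range.
- intros r y _ Hy; lra.
- intros r y _ Hy; lra.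
- exact front_derive.
- exact front_speed_continuous.
- intros t Ht; replace (0 + 1 * s t) with (s t) by ring; now apply melting_at_front.
- rewrite Hs0; apply Hadm.
Qed.

Lemma solid_phase : phase (alpha_s P) (len P) tau solid_width (fun t => - front_speed t)
  solid solid_dx (@phase_uxx Tsxx (len P) (-1)).
Proof.
apply (phase_of_classical_heat Hsol); trivial.
- ring.
- exact solid_range.
- unfold solid_width; intros r y _ Hy; lra.
- unfold solid_width; intros r y _ Hy; lra.
- exact solid_width_continuous.
- intros t Ht; replace (- front_speed t) with (0 - front_speed t) by ring.
  apply (is_derive_minus (fun _ => len P) s); [apply (is_derive_const (len P) t) | now apply front_derive].
- intros t Ht; apply (continuous_opp front_speed); now apply front_speed_continuous.
- intros t Ht; replace (len P + -1 * solid_width t) with (s t) by (unfold solid_width; ring).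
  now apply melting_at_front.
- rewrite Hs0; apply Hadm.
Qed.

(** * Heat balance and the closed-loop heat input *)

Lemma liquid_heat_eq (t : R) : 0 <= t < tau ->
  RInt (fun x => Tl x t - T_m P) 0 (s t) = heat s liquid t.
Proof.
intros Ht; destruct (Htwo t Ht).
apply RInt_ext_R; [lra|]; intros x Hx; rewrite liquid_inside; lra.
Qed.

Lemma liquid_energy_eq (t : R) : 0 <= t < tau ->
  RInt (fun x => (Tl x t - T_m P) ^ 2) 0 (s t) = energy s liquid t.
Proof.
intros Ht; destruct (Htwo t Ht).
apply RInt_ext_R; [lra|]; intros x Hx; rewrite liquid_inside; lra.
Qed.

Lemma solid_heat_eq (t : R) : 0 <= t < tau ->
  RInt (fun x => Ts x t - T_m P) (s t) (len P) = - heat solid_width solid t.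
Proof.
intros Ht; destruct (Htwo t Ht).
assert (Hw : 0 <= solid_width t) by (unfold solid_width; lra).
pose proof (ex_RInt_heat solid_phase t Ht) as Hi.
assert (E : forall x, 0 < x < solid_width t -> -1 * solid x t = Ts (len P - x) t - T_m P).
{ intros x Hx; rewrite solid_inside; lra. }
rewrite RInt_reflect; fold (solid_width t).
- rewrite <- (RInt_ext_R (fun x => -1 * solid x t)) by trivial.
  rewrite RInt_scal_R by trivial.
  change (-1 * heat solid_width solid t = - heat solid_width solid t); ring.
- lra.
- apply (ex_RInt_ext_R (fun x => -1 * solid x t)); trivial; now apply ex_RInt_scal_R.
Qed.

Lemma solid_energy_eq (t : R) : 0 <= t < tau ->
  RInt (fun x => (Ts x t - T_m P) ^ 2) (s t) (len P) = energy solid_width solid t.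
Proof.
intros Ht; destruct (Htwo t Ht).
assert (Hw : 0 <= solid_width t) by (unfold solid_width; lra).
pose proof (ex_RInt_energy solid_phase t Ht) as Hi.
assert (E : forall x, 0 < x < solid_width t -> solid x t ^ 2 = (Ts (len P - x) t - T_m P) ^ 2).
{ intros x Hx; rewrite solid_inside by lra; ring. }
rewrite RInt_reflect; fold (solid_width t).
- symmetry; now apply RInt_ext_R.
- lra.
- now apply (ex_RInt_ext_R (fun x => solid x t ^ 2)).
Qed.

Lemma feedback_eq (t : R) : 0 <= t < tau ->
  feedback P c sr Tl Ts s t = - c * setpoint_gap t.
Proof.
intros Ht; unfold feedback, setpoint_gap.
rewrite liquid_heat_eq, solid_heat_eq by trivial; ring.
Qed.

Lemma Psi_eq (t : R) : 0 <= t < tau ->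
  Psi P sr Tl Ts s t = energy s liquid t + energy solid_width solid t + (s t - sr) ^ 2.
Proof.
intros Ht; unfold Psi; now rewrite liquid_energy_eq, solid_energy_eq.
Qed.

(** [s_infty] is the front position at which both phases at melting temperature would have the
    initial heat content. (A3) thus makes the initial gap negative. *)
Lemma setpoint_gap_initial : setpoint_gap 0 = gamma P * (s_infty P Tl0 Ts0 s0 - sr).
Proof.
pose proof (Htwo 0 ltac:(lra)) as [H1 H2].
unfold setpoint_gap.
rewrite <- (liquid_heat_eq 0) by lra.
replace (heat solid_width solid 0) with (- (- heat solid_width solid 0)) by ring.
rewrite <- (solid_heat_eq 0) by lra.
rewrite (RInt_ext_R (fun x => Tl x 0 - T_m P) (fun x => Tl0 x - T_m P)).
2: lra.
2: intros x Hx; rewrite (heat_init _ _ _ _ _ _ _ _ _ Hl); lra.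
rewrite (RInt_ext_R (fun x => Ts x 0 - T_m P) (fun x => Ts0 x - T_m P)).
2: lra.
2: intros x Hx; rewrite (heat_init _ _ _ _ _ _ _ _ _ Hsol); lra.
rewrite Hs0; unfold s_infty.
pose proof (gamma_pos P); pose proof (alpha_l_pos P); pose proof (alpha_s_pos P).
field; lra.
Qed.

(** The gradients at the front produced by the two heats cancel against [gamma * s'] by the
    interface condition, and the end at [L] is insulated. Only the heat input remains. *)
Lemma setpoint_gap_derive (t : R) : 0 < t < tau ->
  is_derive setpoint_gap t (- c * setpoint_gap t).
Proof.
intros Ht; pose proof (Htwo t ltac:(lra)) as H2.
destruct (Hbc t ltac:(lra) H2) as (E1 & E2 & _); destruct H2.
rewrite <- feedback_eq by lra.
set (q := feedback P c sr Tl Ts s t) in *.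
pose proof (heat_derive liquid_phase t Ht) as D1.
pose proof (heat_derive solid_phase t Ht) as D2.
pose proof (front_derive t Ht) as D3.
pose proof (gamma_pos P); pose proof (alpha_l_pos P); pose proof (alpha_s_pos P).
pose proof (k_l_pos P).
unfold setpoint_gap; auto_derive.
- repeat split; eexists; eassumption.
- change (Derive (fun x => heat s liquid x) t) with (Derive (heat s liquid) t).
  change (Derive (fun x => heat solid_width solid x) t) with (Derive (heat solid_width solid) t).
  change (Derive (fun x => s x) t) with (Derive s t).
  rewrite (is_derive_unique _ _ _ D1), (is_derive_unique _ _ _ D2), (is_derive_unique _ _ _ D3).
  unfold front_speed.
  rewrite (liquid_dx_inside 0), (solid_dx_inside 0) by (unfold solid_width; lra).
  rewrite Rminus_0_r, E1, E2.
  field; lra.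
Qed.

Lemma setpoint_gap_eq (t : R) : 0 <= t < tau ->
  setpoint_gap t = setpoint_gap 0 * exp (- c * t).
Proof.
intros Ht.
(* Taken with [k = 1] and [k = -1], monotonicity from time 0 gives both inequalities, so the product
   is constant up to and including time 0. *)
set (F := fun k t => k * (setpoint_gap t * exp (c * t))).
assert (HFc : forall k, continuous (fun t => F k (Rabs t)) 0).
{ intros k; apply (continuous_mult (fun _ => k)); [apply continuous_const|].
  apply (continuous_mult (fun t => setpoint_gap (Rabs t)) (fun t => exp (c * Rabs t))).
  - apply (continuous_plus (fun t => k_l P / alpha_l P * heat s liquid (Rabs t)
      - k_s P / alpha_s P * heat solid_width solid (Rabs t))
      (fun t => gamma P * (s (Rabs t) - sr))).
    + apply (continuous_minus (fun t => k_l P / alpha_l P * heat s liquid (Rabs t))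
        (fun t => k_s P / alpha_s P * heat solid_width solid (Rabs t))).
      * apply (continuous_mult (fun _ => k_l P / alpha_l P)); [apply continuous_const|].
        apply (energy_initial liquid_phase (fun v => v)); trivial; intros; apply continuous_id.
      * apply (continuous_mult (fun _ => k_s P / alpha_s P)); [apply continuous_const|].
        apply (energy_initial solid_phase (fun v => v)); trivial; intros; apply continuous_id.
    + apply (continuous_mult (fun _ => gamma P) (fun t => s (Rabs t) - sr)); [apply continuous_const|].
      apply (continuous_minus (fun t => s (Rabs t)) (fun _ => sr)); [| apply continuous_const].
      apply (front_Rabs_continuous Hs); lra.
  - apply (continuous_comp (fun t => c * Rabs t) exp); [| apply continuous_exp].
    apply (continuous_mult (fun _ => c) Rabs); [apply continuous_const | apply continuous_Rabs]. }
assert (HFd : forall k t, 0 < t < tau -> is_derive (F k) t 0).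
{ intros k r Hr; pose proof (setpoint_gap_derive r Hr) as D.
  unfold F; auto_derive.
  - eexists; exact D.
  - change (Derive (fun x => setpoint_gap x) r) with (Derive setpoint_gap r).
    rewrite (is_derive_unique _ _ _ D); ring. }
assert (H1 := nonincreasing_from_initial (F 1) (fun _ => 0) tau (HFc 1) (HFd 1) ltac:(intros; lra) t Ht).
assert (H2 := nonincreasing_from_initial (F (-1)) (fun _ => 0) tau (HFc (-1)) (HFd (-1)) ltac:(intros; lra) t Ht).
unfold F in H1, H2; rewrite Rmult_0_r, exp_0 in H1, H2.
assert (E : setpoint_gap t * exp (c * t) = setpoint_gap 0) by lra.
rewrite <- E, Rmult_assoc, <- exp_plus.
replace (c * t + - c * t) with 0 by ring; rewrite exp_0; ring.
Qed.

Lemma setpoint_gap_initial_neg : setpoint_gap 0 < 0.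
Proof.
rewrite setpoint_gap_initial; pose proof (gamma_pos P); nra.
Qed.

Lemma setpoint_gap_bounds (t : R) : 0 <= t < tau -> setpoint_gap 0 <= setpoint_gap t < 0.
Proof.
intros Ht; rewrite (setpoint_gap_eq t Ht); pose proof setpoint_gap_initial_neg.
pose proof (exp_pos (- c * t)).
assert (exp (- c * t) <= 1) by (rewrite <- exp_0; apply exp_nondecreasing; nra).
nra.
Qed.

(** Initial heat input divided by the conductivity: the amplitude [b] in [energy_decay]. *)
Definition inflow : R := - c * setpoint_gap 0 / k_l P.

Lemma liquid_flux (t : R) : 0 < t < tau -> liquid_dx 0 t = - (inflow * exp (- c * t)).
Proof.
intros Ht; pose proof (Htwo t ltac:(lra)) as H2.
destruct (Hbc t ltac:(lra) H2) as (E1 & _); destruct H2.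
pose proof (k_l_pos P).
rewrite liquid_dx_inside, E1, feedback_eq, setpoint_gap_eq by lra.
unfold inflow; field; lra.
Qed.

Lemma solid_flux (t : R) : 0 < t < tau -> solid_dx 0 t = 0.
Proof.
intros Ht; pose proof (Htwo t ltac:(lra)) as H2.
destruct (Hbc t ltac:(lra) H2) as (_ & E2 & _); destruct H2.
rewrite solid_dx_inside by (unfold solid_width; lra).
now rewrite Rminus_0_r.
Qed.

(** * Signs, decay, and distance of the front from both ends *)

Lemma liquid_nonneg (x t : R) : 0 <= t < tau -> 0 < x < s t -> 0 <= liquid x t.
Proof.
intros Ht Hx.
assert (H0 : forall x, 0 < x < s 0 -> 0 <= liquid x 0).
{ intros y Hy; rewrite liquid_inside by lra.
  rewrite (heat_init _ _ _ _ _ _ _ _ _ Hl) by lra.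
  destruct Hadm as (_ & _ & _ & Hl' & Hs' & _ & _ & B1 & _).
  specialize (B1 y); lra. }
destruct (Req_dec t 0) as [->|Hne]; [now apply H0|].
apply (phase_nonneg liquid_phase); trivial; try lra.
- left; apply alpha_l_pos.
- intros r Hr; rewrite liquid_flux by trivial.
  (* A setpoint beyond [s_infty] makes the controller heat and never cool. *)
  assert (0 < inflow).
  { unfold inflow; pose proof setpoint_gap_initial_neg; pose proof (k_l_pos P).
    apply Rdiv_lt_0_compat; nra. }
  pose proof (exp_pos (- c * r)); nra.
Qed.

Lemma solid_nonneg (x t : R) : 0 <= t < tau -> 0 < x < solid_width t -> 0 <= solid x t.
Proof.
intros Ht Hx.
assert (H0 : forall x, 0 < x < solid_width 0 -> 0 <= solid x 0).
{ intros y Hy; rewrite solid_inside by lra.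
  pose proof (Htwo 0 ltac:(lra)) as [H1 H2]; unfold solid_width in Hy.
  rewrite (heat_init _ _ _ _ _ _ _ _ _ Hsol) by lra.
  destruct Hadm as (_ & _ & _ & Hl' & Hs' & _ & _ & _ & B2).
  specialize (B2 (len P - y)); lra. }
destruct (Req_dec t 0) as [->|Hne]; [now apply H0|].
apply (phase_nonneg solid_phase); trivial; try lra.
- left; apply alpha_s_pos.
- intros r Hr; rewrite solid_flux by trivial; lra.
Qed.

Definition liquid_bound : R :=
  energy s liquid 0 + alpha_l P * len P * inflow ^ 2 / c.

Lemma liquid_bound_nonneg : 0 <= liquid_bound.
Proof.
unfold liquid_bound.
pose proof (energy_nonneg liquid_phase 0 ltac:(lra)).
assert (0 <= alpha_l P * len P * inflow ^ 2 / c); [| lra].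
apply Rdiv_le_0_compat; trivial.
pose proof (alpha_l_pos P); pose proof (len_pos P).
apply Rmult_le_pos; [nra | apply pow2_ge_0].
Qed.

Lemma liquid_energy_decay (d t : R) : d <= alpha_l P / len P ^ 2 -> d <= c -> 0 <= t < tau ->
  energy s liquid t * exp (d * t) <= liquid_bound.
Proof.
intros H1 H2 Ht; apply (energy_decay liquid_phase); trivial.
- apply alpha_l_pos.
- exact liquid_flux.
Qed.

Lemma solid_energy_decay (d t : R) : d <= alpha_s P / len P ^ 2 -> d <= c -> 0 <= t < tau ->
  energy solid_width solid t * exp (d * t) <= energy solid_width solid 0.
Proof.
intros H1 H2 Ht.
replace (energy solid_width solid 0) with
  (energy solid_width solid 0 + alpha_s P * len P * 0 ^ 2 / c) by (field; lra).
apply (energy_decay solid_phase); trivial.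
- apply alpha_s_pos.
- intros r Hr; rewrite solid_flux by trivial; ring.
Qed.

(** The gap stays between [gamma * (s_infty - sr)] and 0. Dropping the solid heat from the lower
    bound gives [gamma * (s_infty - s) <= k_l / alpha_l * heat] for the liquid; dropping the liquid
    heat from the upper bound gives [gamma * (s - sr) <= k_s / alpha_s * heat] for the solid. The
    margins are [s_infty > 0] and [len P - sr > 0]. *)
Lemma front_bounds : exists delta, 0 < delta /\
  forall t, 0 <= t < tau -> delta <= s t <= len P - delta.
Proof.
pose proof (gamma_pos P); pose proof (alpha_l_pos P); pose proof (alpha_s_pos P).
pose proof (k_l_pos P); pose proof (k_s_pos P); pose proof (len_pos P).
pose proof (energy_nonneg solid_phase 0 ltac:(lra)).
assert (HA : 0 < k_l P / alpha_l P) by now apply Rdiv_lt_0_compat.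
assert (HB : 0 < k_s P / alpha_s P) by now apply Rdiv_lt_0_compat.
assert (HlL : 0 <= alpha_l P / len P ^ 2) by (apply Rdiv_le_0_compat; [lra | now apply pow_lt]).
assert (HsL : 0 <= alpha_s P / len P ^ 2) by (apply Rdiv_le_0_compat; [lra | now apply pow_lt]).
destruct (front_away (gamma P) (k_l P / alpha_l P) (s_infty P Tl0 Ts0 s0) liquid_bound)
  as [d1 [Hd1 HF1]]; trivial; try apply Hinf; try apply liquid_bound_nonneg.
destruct (front_away (gamma P) (k_s P / alpha_s P) (len P - sr) (energy solid_width solid 0))
  as [d2 [Hd2 HF2]]; trivial; try lra.
exists (Rmin d1 d2); split; [now apply Rmin_pos|].
intros t Ht; destruct (Htwo t Ht) as [Hs1 Hs2].
pose proof (Rmin_l d1 d2); pose proof (Rmin_r d1 d2).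
pose proof (setpoint_gap_bounds t Ht) as HG.
rewrite setpoint_gap_initial in HG; unfold setpoint_gap in HG.
assert (HU : 0 <= heat s liquid t).
{ apply RInt_ge_0; [lra | now apply (ex_RInt_heat liquid_phase) |].
  intros x Hx; now apply liquid_nonneg. }
assert (HV : 0 <= heat solid_width solid t).
{ apply RInt_ge_0; [unfold solid_width; lra | now apply (ex_RInt_heat solid_phase) |].
  intros x Hx; now apply solid_nonneg. }
(* With rate 0 the decay estimates are plain bounds on the energies. *)
assert (E1 := liquid_energy_decay 0 t HlL ltac:(lra) Ht).
assert (E2 := solid_energy_decay 0 t HsL ltac:(lra) Ht).
rewrite Rmult_0_l, exp_0, Rmult_1_r in E1, E2.
assert (0 <= k_l P / alpha_l P * heat s liquid t) by now apply Rmult_le_pos; lra.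
assert (0 <= k_s P / alpha_s P * heat solid_width solid t) by now apply Rmult_le_pos; lra.
assert (d1 <= s t).
{ apply (HF1 (s t) (heat s liquid t)); [lra | lra |].
  eapply Rle_trans; [now apply (heat_square_le liquid_phase)|].
  apply Rmult_le_compat_l; lra. }
assert (Hw : solid_width t = len P - s t) by reflexivity.
assert (d2 <= solid_width t).
{ apply (HF2 (solid_width t) (heat solid_width solid t)); [lra | |].
  { replace (len P - sr - solid_width t) with (s t - sr) by lra; lra. }
  eapply Rle_trans; [now apply (heat_square_le solid_phase)|].
  apply Rmult_le_compat_l; lra. }
lra.
Qed.

End UpTo.

(* The solution cannot leave the two-phase regime: up to a first exit time the
   front stays away from both ends of the material. *)
Lemma two_phases_forever (t : R) : 0 <= t -> two_phases P s t.
Proof.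
intros Ht; destruct (classic (two_phases P s t)) as [H|Hbad]; trivial; exfalso.
set (E := fun r => 0 <= r /\ forall q, 0 <= q <= r -> two_phases P s q).
assert (HE0 : E 0).
{ split; [lra|]; intros q Hq; replace q with 0 by lra.
  unfold two_phases; rewrite Hs0; apply Hadm. }
destruct (completeness E) as [tau [Hub Hlub]].
{ exists t; intros r [Hr1 Hr2]; destruct (Rle_or_lt r t) as [H|H]; trivial.
  exfalso; apply Hbad, Hr2; lra. }
{ now exists 0. }
assert (Htau0 : 0 <= tau) by now apply Hub.
assert (Hbefore : forall q, 0 <= q < tau -> two_phases P s q).
{ intros q Hq; apply NNPP; intros Hn.
  assert (Hle : tau <= q); [| lra].
  apply Hlub; intros r [Hr1 Hr2]; destruct (Rle_or_lt r q) as [H|H]; trivial.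
  exfalso; apply Hn, Hr2; lra. }
assert (HsR : continuous (fun r => s (Rabs r)) tau) by now apply (front_Rabs_continuous Hs).
(* At times just before [tau] the front is at least [delta] from both ends, and by continuity it
   moves by less than [delta] up to [tau]. *)
assert (Hat : two_phases P s tau).
{ destruct (Req_dec tau 0) as [E0|Hne]; [rewrite E0; apply HE0; lra|].
  destruct (front_bounds (tau := tau) ltac:(lra) Hbefore) as [delta [Hdelta Hb]].
  apply NNPP; intros Hn.
  assert (Hfar : locally tau (fun r => Rabs (s (Rabs r) - s (Rabs tau)) < delta)).
  { now apply (proj1 (continuous_eps _ _) HsR). }
  destruct Hfar as [d Hd]; pose proof (cond_pos d).
  set (q := tau - Rmin (d / 2) (tau / 2)).
  assert (0 < Rmin (d / 2) (tau / 2)) by (apply Rmin_pos; lra).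
  pose proof (Rmin_l (d / 2) (tau / 2)); pose proof (Rmin_r (d / 2) (tau / 2)).
  assert (Hqd : Rabs (q - tau) < d) by (rewrite Rabs_left; unfold q; lra).
  assert (Hq : Rabs (s (Rabs q) - s (Rabs tau)) < delta) by exact (Hd q Hqd).
  rewrite (Rabs_pos_eq q), (Rabs_pos_eq tau) in Hq by (unfold q; lra).
  specialize (Hb q ltac:(unfold q; lra)).
  apply Rabs_def2 in Hq; apply Hn; unfold two_phases; lra. }
assert (Hopen : locally tau (fun r => 0 < s (Rabs r) < len P)).
{ apply (HsR (fun v => 0 < v < len P)).
  rewrite Rabs_pos_eq by trivial; now apply locally_open_interval. }
destruct Hopen as [d Hd]; pose proof (cond_pos d).
assert (HE : E (tau + d / 2)).
{ split; [lra|]; intros q Hq.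
  destruct (Rle_or_lt tau q) as [Hle|Hlt]; [| apply Hbefore; lra].
  unfold two_phases; rewrite <- (Rabs_pos_eq q) by lra.
  apply Hd; change (Rabs (q - tau) < d); rewrite Rabs_pos_eq; lra. }
specialize (Hub _ HE); lra.
Qed.

Lemma two_phases_before (tau t : R) : 0 <= t < tau -> two_phases P s t.
Proof. intros Ht; now apply two_phases_forever. Qed.

Lemma model_validity (t : R) : 0 < t ->
  (forall x, 0 < x < s t -> T_m P <= Tl x t) /\
  (forall x, s t < x < len P -> Ts x t <= T_m P) /\
  0 < s t < len P.
Proof.
intros Ht; destruct (two_phases_forever t ltac:(lra)) as [Hs1 Hs2].
repeat split; trivial; intros x Hx.
(* Both phases now being present at all times, any horizon beyond [t] serves. *)
- pose proof (liquid_nonneg (tau := t + 1) ltac:(lra) (two_phases_before _) x t ltac:(lra) Hx) as H.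
  rewrite liquid_inside in H; lra.
- pose proof (solid_nonneg (tau := t + 1) ltac:(lra) (two_phases_before _) (len P - x) t ltac:(lra)) as H.
  unfold solid_width in H; specialize (H ltac:(lra)).
  rewrite solid_inside in H by (unfold solid_width; lra).
  replace (len P - (len P - x)) with x in H by ring; lra.
Qed.

Lemma decay_rate_le :
  decay_rate P c <= alpha_l P / len P ^ 2 /\ decay_rate P c <= alpha_s P / len P ^ 2 /\
  decay_rate P c <= c.
Proof.
unfold decay_rate.
pose proof (alpha_l_pos P); pose proof (alpha_s_pos P); pose proof (len_pos P).
assert (HL : 0 < len P ^ 2) by now apply pow_lt.
assert (0 < alpha_l P / len P ^ 2) by now apply Rdiv_lt_0_compat.
assert (0 < alpha_s P / len P ^ 2) by now apply Rdiv_lt_0_compat.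
assert (alpha_l P / (2 * len P ^ 2) = alpha_l P / len P ^ 2 / 2) by (field; lra).
set (m := Rmin (alpha_s P / len P ^ 2) c).
pose proof (Rmin_l (alpha_l P / (2 * len P ^ 2)) m).
pose proof (Rmin_r (alpha_l P / (2 * len P ^ 2)) m).
assert (m <= alpha_s P / len P ^ 2) by apply Rmin_l.
assert (m <= c) by apply Rmin_r.
lra.
Qed.

(** If it were zero, both energies would vanish, hence both heats by Cauchy-Schwarz, and [s 0 = sr];
    the initial gap would be zero although it is negative. *)
Lemma Psi_initial_pos : 0 < Psi P sr Tl Ts s 0.
Proof.
assert (H1 : 0 < 1) by lra.
assert (Hr : 0 <= 0 < 1) by lra.
rewrite (Psi_eq H1 (two_phases_before 1) 0 Hr).
pose proof (energy_nonneg (liquid_phase H1 (two_phases_before 1)) 0 Hr) as EU.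
pose proof (energy_nonneg (solid_phase H1 (two_phases_before 1)) 0 Hr) as EV.
pose proof (heat_square_le (liquid_phase H1 (two_phases_before 1)) 0 Hr) as HU.
pose proof (heat_square_le (solid_phase H1 (two_phases_before 1)) 0 Hr) as HV.
pose proof (setpoint_gap_initial_neg H1 (two_phases_before 1)) as HG.
pose proof (pow2_ge_0 (s 0 - sr)) as Hsq.
apply Rnot_le_lt; intros Hle.
assert (E1 : energy s liquid 0 = 0) by lra.
assert (E2 : energy solid_width solid 0 = 0) by lra.
assert (E3 : (s 0 - sr) ^ 2 = 0) by lra.
rewrite E1, Rmult_0_r in HU; rewrite E2, Rmult_0_r in HV.
assert (Z : forall v, v ^ 2 <= 0 -> v = 0) by (intros v Hv; nra).
unfold setpoint_gap in HG.
rewrite (Z _ HU), (Z _ HV), (Z (s 0 - sr)) in HG; lra.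
Qed.

Lemma Psi_decay : exists C, 0 < C /\
  forall t, 0 <= t -> Psi P sr Tl Ts s t <= C * exp (- decay_rate P c * t).
Proof.
set (A := k_l P / alpha_l P); set (B := k_s P / alpha_s P).
set (g0 := setpoint_gap 0).
set (KU := liquid_bound); set (KV := energy solid_width solid 0).
set (d := decay_rate P c).
(* Solving the definition of the gap for [gamma * (s - sr)] leaves three decaying terms, and the
   square of a sum of three terms is at most 3 times the sum of their squares. *)
set (S := 3 * (g0 ^ 2 + A ^ 2 * (len P * KU) + B ^ 2 * (len P * KV))).
pose proof (gamma_pos P) as Hg; pose proof (len_pos P).
assert (HKU : 0 <= KU) by apply (liquid_bound_nonneg (tau := 1) ltac:(lra) (two_phases_before 1)).
assert (HKV : 0 <= KV) by apply (energy_nonneg (solid_phase (tau := 1) ltac:(lra) (two_phases_before 1)) 0 ltac:(lra)).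
assert (HS : 0 <= S).
{ unfold S; pose proof (pow2_ge_0 g0); pose proof (pow2_ge_0 A); pose proof (pow2_ge_0 B).
  assert (0 <= len P * KU) by nra; assert (0 <= len P * KV) by nra; nra. }
assert (Hg2 : 0 < gamma P ^ 2) by now apply pow_lt.
assert (HSg : 0 <= S / gamma P ^ 2) by now apply Rdiv_le_0_compat.
(* The three summands bound the two energies and the front error; the added 1 secures strict
   positivity. *)
exists (KU + KV + S / gamma P ^ 2 + 1); split; [lra|].
intros t Ht.
assert (Htau : 0 < t + 1) by lra.
assert (Hr : 0 <= t < t + 1) by lra.
pose proof (two_phases_before (t + 1)) as H2.
destruct (H2 t Hr) as [Hs1 Hs2].
destruct decay_rate_le as (D1 & D2 & D3); fold d in D1, D2, D3.
rewrite (Psi_eq Htau H2 t Hr).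
pose proof (liquid_energy_decay Htau H2 d t D1 D3 Hr) as EU; fold KU in EU.
pose proof (solid_energy_decay Htau H2 d t D2 D3 Hr) as EV; fold KV in EV.
pose proof (energy_nonneg (liquid_phase Htau H2) t Hr) as EU0.
pose proof (energy_nonneg (solid_phase Htau H2) t Hr) as EV0.
pose proof (heat_square_le (liquid_phase Htau H2) t Hr) as HU.
pose proof (heat_square_le (solid_phase Htau H2) t Hr) as HV.
pose proof (setpoint_gap_eq Htau H2 t Hr) as HG; fold g0 in HG.
assert (HG' : setpoint_gap t = A * heat s liquid t - B * heat solid_width solid t + gamma P * (s t - sr))
  by reflexivity.
set (x := exp (- d * t)).
assert (Hx : 0 < x) by apply exp_pos.
assert (Hinv : exp (d * t) * x = 1).
{ unfold x; rewrite <- exp_plus; replace (d * t + - d * t) with 0 by ring; apply exp_0. }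
assert (FU : energy s liquid t <= KU * x).
{ apply (Rmult_le_compat_r x) in EU; [| lra].
  now rewrite Rmult_assoc, Hinv, Rmult_1_r in EU. }
assert (FV : energy solid_width solid t <= KV * x).
{ apply (Rmult_le_compat_r x) in EV; [| lra].
  now rewrite Rmult_assoc, Hinv, Rmult_1_r in EV. }
assert (FG : setpoint_gap t ^ 2 <= g0 ^ 2 * x).
{ rewrite HG, Rpow_mult_distr; apply Rmult_le_compat_l; [apply pow2_ge_0|].
  replace (exp (- c * t) ^ 2) with (exp (- c * t) * exp (- c * t)) by ring.
  rewrite <- exp_plus; apply exp_nondecreasing; nra. }
assert (GU : heat s liquid t ^ 2 <= len P * KU * x).
{ eapply Rle_trans; [exact HU|]; rewrite Rmult_assoc; apply Rmult_le_compat; lra. }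
assert (GV : heat solid_width solid t ^ 2 <= len P * KV * x).
{ eapply Rle_trans; [exact HV|]; rewrite Rmult_assoc.
  apply Rmult_le_compat; trivial; unfold solid_width; lra. }
assert (Hfront : (gamma P * (s t - sr)) ^ 2 <= S * x).
{ replace (gamma P * (s t - sr)) with
    (setpoint_gap t - A * heat s liquid t + B * heat solid_width solid t) by (rewrite HG'; ring).
  apply Rle_trans with (3 * (setpoint_gap t ^ 2 + A ^ 2 * heat s liquid t ^ 2
    + B ^ 2 * heat solid_width solid t ^ 2)).
  (* The difference of the two sides is exactly the sum of these three squares. *)
  - pose proof (pow2_ge_0 (setpoint_gap t + A * heat s liquid t)).
    pose proof (pow2_ge_0 (setpoint_gap t - B * heat solid_width solid t)).
    pose proof (pow2_ge_0 (A * heat s liquid t + B * heat solid_width solid t)).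
    nra.
  - apply (Rmult_le_compat_l (A ^ 2)) in GU; [| apply pow2_ge_0].
    apply (Rmult_le_compat_l (B ^ 2)) in GV; [| apply pow2_ge_0].
    unfold S; lra. }
assert (Hsq : (s t - sr) ^ 2 <= S / gamma P ^ 2 * x).
{ replace (S / gamma P ^ 2 * x) with (S * x / gamma P ^ 2) by (field; lra).
  apply (proj1 (Rle_div_r _ _ _ Hg2)).
  now rewrite Rmult_comm, <- Rpow_mult_distr. }
lra.
Qed.

End ClosedLoop.

Theorem theorem1 (P : material) (c : R) (Tl0 Ts0 : R -> R) (s0 sr : R)
    (Tl Ts : R -> R -> R) (s : R -> R) :
  0 < c ->
  admissible_data P Tl0 Ts0 s0 ->
  0 < s_infty P Tl0 Ts0 s0 < len P ->
  s_infty P Tl0 Ts0 s0 < sr < len P ->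
  stefan_solution P (feedback P c sr Tl Ts s) Tl0 Ts0 s0 Tl Ts s ->
  (forall t, 0 < t ->
     (forall x, 0 < x < s t -> T_m P <= Tl x t) /\
     (forall x, s t < x < len P -> Ts x t <= T_m P) /\
     0 < s t < len P) /\
  exists M : R, 0 < M /\
    forall t, 0 <= t ->
      Psi P sr Tl Ts s t
        <= M * Psi P sr Tl Ts s 0 * exp (- decay_rate P c * t).
Proof.
intros Hc Hadm Hinf Hsr (Hs0 & Hs & Tlx & Tlxx & Tlt & Tsx & Tsxx & Tst & Hl & Hsol & Hbc).
split.
- intros t Ht; now apply (model_validity Hc Hadm Hinf Hsr Hs0 Hs Hl Hsol Hbc).
- destruct (Psi_decay Hc Hadm Hinf Hsr Hs0 Hs Hl Hsol Hbc) as [C [HC H]].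
  pose proof (Psi_initial_pos Hc Hadm Hinf Hsr Hs0 Hs Hl Hsol Hbc) as H0.
  exists (C / Psi P sr Tl Ts s 0); split; [now apply Rdiv_lt_0_compat|].
  intros t Ht.
  replace (C / Psi P sr Tl Ts s 0 * Psi P sr Tl Ts s 0) with C by (field; lra).
  now apply H.
Qed.
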